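(* For each fixed odd positive integer $d$, let $\mathcal{G}_{n,d}$ be a uniformly random $d$-regular (simple) graph on $n$ vertices (with $n$ ranging over integers for which such graphs exist). Then the probability that $\mathcal{G}_{n,d}$ is strongly consistent tends to $1$ as $n\to\infty$.
   Context: All graphs are finite and simple. A digraph here has no loops and, between two distinct vertices, at most one edge in each direction; an oriented graph has at most one edge between any two vertices. For a digraph $D$, $\mathrm{pn}(D)$ is the minimum number of (directed) paths into which the edge set of $D$ can be partitioned, and the excess is $\mathrm{ex}(D)=\frac12\sum_{v\in V(D)}|d^+(v)-d^-(v)|$. $D$ is consistent if $\mathrm{pn}(D)=\mathrm{ex}(D)$. An undirected graph $G$ is strongly consistent if every orientation of $G$ is consistent. *)

(* Defs.v *)
From HB Require Import structures.
From mathcomp Require Import all_boot all_order all_algebra.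
From mathcomp Require Import boolp classical_sets reals topology normedtype.

Set Implicit Arguments.
Unset Strict Implicit.
Unset Printing Implicit Defensive.

Import Order.TTheory GRing.Theory Num.Theory.
Import numFieldNormedType.Exports.

Section Digraphs.
Variable V : finType.

Definition loopless (A : {set V * V}) : bool := [forall x, (x, x) \notin A].

Record digraph := Digraph { arcs : {set V * V}; _ : loopless arcs }.

Definition outdeg (D : digraph) (v : V) : nat := #|[set y | (v, y) \in arcs D]%SET|.
Definition indeg (D : digraph) (v : V) : nat := #|[set y | (y, v) \in arcs D]%SET|.

Definition excess (D : digraph) : rat :=
  (2^-1 * \sum_(v : V) `|(outdeg D v)%:R - (indeg D v)%:R|)%R.

(* [P] is the edge set of the directed path visiting the pairwise distinct
   vertices [s] in order. The empty [P] is not excluded here, but it is never a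
   block of a [partition]. *)
Definition dipath (P : {set V * V}) : Prop :=
  exists2 s : seq V, uniq s & P = [set e in zip s (behead s)]%SET.

Definition path_decomposition (D : digraph) (F : {set {set V * V}}) : Prop :=
  finset.partition F (arcs D) /\ forall P, P \in F -> dipath P.

Definition has_path_decomposition (D : digraph) (k : nat) : Prop :=
  exists2 F, path_decomposition D F & #|F| = k.

Lemma path_decomposition_ex (D : digraph) :
  exists k, `[< has_path_decomposition D k >].
Proof.
pose F := [set [set e] | e in arcs D]%SET.
exists #|F|; apply/asboolP; exists F => //; split; last first.
  move=> _ /imsetP[[x y] Dxy ->].
  have neq_xy : x != y.
    case: D @F Dxy => A /= /forallP loopA; apply: contraTneq => ->.
    exact: loopA.
  exists [:: x; y]; first by rewrite /= inE neq_xy.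
  by apply/setP=> e; rewrite !inE.
apply/and3P; split.
- by rewrite finset.cover_imset; apply/eqP/setP=> e; apply/bigcupP/idP =>
    [[e' De' /set1P->]//|De]; exists e; rewrite ?set11.
- apply/finset.trivIsetP=> _ _ /imsetP[e De ->] /imsetP[e' De' ->] neq.
  by rewrite disjoints1 inE; apply: contraNneq neq => ->.
- by apply/imsetP=> -[e _ /setP/(_ e)]; rewrite !inE eqxx.
Qed.

Definition pn (D : digraph) : nat := ex_minn (path_decomposition_ex D).

Definition consistent (D : digraph) : Prop := ((pn D)%:R = excess D)%R.

Definition oriented (D : digraph) : Prop :=
  forall x y, (x, y) \in arcs D -> (y, x) \notin arcs D.

End Digraphs.

Section Graphs.
Variable V : finType.

Definition all_pairs (E : {set {set V}}) : bool := [forall e in E, #|e| == 2].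

Record sgraph := SGraph { edges : {set {set V}}; _ : all_pairs edges }.

HB.instance Definition _ := [isSub for edges].
HB.instance Definition _ := [Finite of sgraph by <:].

Definition degree (G : sgraph) (v : V) : nat := #|[set e in edges G | v \in e]%SET|.

Definition regular (d : nat) (G : sgraph) : bool := [forall v, degree G v == d].

Definition orientation (G : sgraph) (D : digraph V) : Prop :=
  oriented D /\ [set [set a.1; a.2] | a in arcs D]%SET = edges G.

Definition strongly_consistent (G : sgraph) : Prop :=
  forall D : digraph V, orientation G D -> consistent D.

End Graphs.

Definition regular_graphs (n d : nat) : {set sgraph 'I_n} :=
  [set G | regular d G]%SET.

(* Probability of the event [Q] under the uniform distribution on [A]; only
   meaningful when [A] is nonempty. *)
Definition uniform_prob (R : realType) (T : finType) (A : {set T})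
    (Q : T -> Prop) : R :=
  (#|[set x in A | `[< Q x >]]%SET|%:R / #|A|%:R)%R.

(* Main.v *)
(* In an orientation of a d-regular graph with d odd, a vertex v with p out-arcs
   and q in-arcs has p <> q. Number the in-arcs and the out-arcs at v and, for a shift
   s below m = max(p, q), join the i-th in-arc to the j-th out-arc when
   j = i + s mod m. This decomposes the arcs into trails, and the number of
   trails that start somewhere is exactly the excess; so the digraph is
   consistent as soon as no trail visits a vertex twice. The latter fails only
   if, for some directed cycle, the shifts join consecutive arcs of the cycle at
   all its vertices but one.

   A random shift joins two given arcs with probability 1/m, and
   1/m^2 <= (d/(d+1))^2 (1/p)(1/q). By AM-GM the probabilities of the cycles of
   length l through a given vertex therefore add up to at most (d/(d+1))^l times
   an average of total masses of a forward and a backward random walk: they decay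
   exponentially in l, and a local-lemma argument (in Rosenfeld's counting form)
   avoids all long cycles at once. If every set of at most K vertices spans at
   most as many edges as vertices, then short cycles are far apart; the shifts at
   their vertices can be chosen by hand to break them, at a negligible cost for
   the long cycles.

   Finally, switchings show that a fixed set of h edges lies in a random
   d-regular graph with probability O(n^-h), so by the first moment method the
   sparsity condition holds with probability 1 - O(1/n). *)
Require Import Defs.
From mathcomp Require Import all_boot all_order all_algebra.
From mathcomp Require Import boolp zify ring lra.

Set Implicit Arguments.
Unset Strict Implicit.
Unset Printing Implicit Defensive.

Import Order.TTheory GRing.Theory Num.Theory.

(** * Avoiding rare events *)

Section Avoidance.
Variables (V W : finType) (w0 : W) (choices : V -> {set W}).
Variables (I : eqType) (evs : seq I) (supp : I -> {set V}) (value : I -> V -> W).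
Variable c : V -> rat.

Definition occurs (i : I) (f : {ffun V -> W}) :=
  [forall u in supp i, f u == value i u].

(* Outside of [T] the value is pinned to [w0], so that the total functions
   counted below stand for partial functions on [T]. *)
Definition choosing (T : {set V}) (f : {ffun V -> W}) :=
  [forall v, if v \in T then f v \in choices v else f v == w0].

(** An event is tested only when [S] contains its whole support, so the outcome depends on [f] over
    [S] alone. *)
Definition avoiding (S : {set V}) (f : {ffun V -> W}) :=
  all (fun i => (supp i \subset S) ==> ~~ occurs i f) evs.

Definition good (S : {set V}) : {set {ffun V -> W}} :=
  [set f | choosing S f && avoiding S f].

Lemma eq_avoiding (S : {set V}) (f g : {ffun V -> W}) :
  {in S, f =1 g} -> avoiding S f = avoiding S g.
Proof.
move=> fg; apply: eq_all => i; case: (boolP (_ \subset _)) => //= /subsetP sS.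
congr (~~ _); apply: eq_forallb => u.
by case: (boolP (u \in supp i)) => //= /sS/fg ->.
Qed.

(** The condition [avoiding S] ignores the value at [v], which can therefore be split off and chosen
    freely. *)
Lemma card_good_extend (S : {set V}) v : v \notin S ->
  #|[set f | choosing (v |: S) f && avoiding S f]| = #|good S| * #|choices v|.
Proof.
move=> vS.
pose h (g : {ffun V -> W} * W) := [ffun u => if u == v then g.2 else g.1 u].
have neqv u : u \in S -> (u == v) = false by move=> uS; apply: contraNF vS => /eqP <-.
rewrite -cardsX -(@card_in_imset _ _ h) => [|[g x] [g' x']]; last first.
  rewrite !inE /= => /andP[/andP[/forallP gv _] _] /andP[/andP[/forallP g'v _] _].
  move=> /ffunP eqh; have := eqh v; rewrite !ffunE eqxx /= => ->; congr (_, _).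
  apply/ffunP => u; have := eqh u; rewrite !ffunE; case: eqP => // -> _.
  by have := gv v; have := g'v v; rewrite (negPf vS) => /eqP -> /eqP ->.
apply: eq_card => f; apply/idP/imsetP => [|[[g x]]].
  rewrite inE => /andP[/forallP fS fev].
  exists ([ffun u => if u == v then w0 else f u], f v); last first.
    by apply/ffunP => u; rewrite !ffunE /=; case: eqP => [->|].
  rewrite !inE /= [X in _ && X](_ : _ = true); last first.
    by have := fS v; rewrite !inE eqxx.
  rewrite andbT; apply/andP; split.
    apply/forallP => u; rewrite ffunE; have := fS u; rewrite !inE.
    by case: eqP => [->|//]; rewrite (negPf vS) eqxx.
  by rewrite (@eq_avoiding _ _ f) // => u uS; rewrite ffunE neqv.
rewrite !inE /= => /andP[/andP[/forallP gS gev] xv] ->; apply/andP; split.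
  by apply/forallP => u; rewrite ffunE !inE /=; case: eqP => [->//|_]; apply: gS.
by rewrite (@eq_avoiding _ _ g) // => u uS; rewrite ffunE /= neqv.
Qed.

(* An occurring event prescribes [f] on [supp i], so [f] is determined by its
   restriction to the complement, which is good there. *)
Lemma card_good_occurs (S : {set V}) v i : v \notin S -> v \in supp i ->
  #|[set f | [&& choosing (v |: S) f, avoiding S f & occurs i f]]|
    <= #|good (S :\: (supp i :\ v))|.
Proof.
move=> vS vi.
pose h (f : {ffun V -> W}) := [ffun u => if u \in supp i then w0 else f u].
rewrite -(@card_in_imset _ _ h); last first.
  move=> f g; rewrite !inE => /and3P[_ _ /forallP fi] /and3P[_ _ /forallP gi].
  move=> /ffunP fg; apply/ffunP => u; have := fg u; rewrite !ffunE.
  by case: ifP => // ui _; move: (fi u) (gi u); rewrite ui => /eqP -> /eqP ->.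
apply/subset_leq_card/subsetP => _ /imsetP[f + ->].
rewrite !inE => /and3P[/forallP fS fev _]; apply/andP; split.
  apply/forallP => u; rewrite ffunE !inE; have := fS u; rewrite !inE negb_and negbK.
  case: (eqVneq u v) => [->|_] /=; first by rewrite vi (negPf vS) eqxx.
  by case: (u \in supp i) => //=; rewrite eqxx.
rewrite (@eq_avoiding _ _ f) => [|u]; last first.
  rewrite ffunE !inE negb_and negbK => /andP[+ uS].
  by case: eqP => [vu|_ /= /negPf -> //]; rewrite vu (negPf vS) in uS.
apply: sub_all fev => j /implyP fj; apply/implyP => js; apply: fj.
exact: subset_trans js (subsetDl _ _).
Qed.

(** An extension that is good on [S] but not on [v |: S] makes some event with [v] in its support
    occur; this is a union bound over such events. *)
Lemma card_good_step (S : {set V}) v : v \notin S ->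
  #|good S| * #|choices v| <=
  #|good (v |: S)| +
  \sum_(i <- evs | (v \in supp i) && (supp i \subset v |: S)) #|good (S :\: (supp i :\ v))|.
Proof.
move=> vS; rewrite -card_good_extend //.
pose B i := [set f | [&& choosing (v |: S) f, avoiding S f & occurs i f]].
apply: (@leq_trans (#|good (v |: S)| + 
    \sum_(i <- evs | (v \in supp i) && (supp i \subset v |: S)) #|B i|)); last first.
  by rewrite leq_add2l; apply: leq_sum => i /andP[vi _]; apply: card_good_occurs.
under [X in _ + X]eq_bigr do rewrite -sum1_card.
rewrite -!sum1_card (eq_bigr (fun i => \sum_(f : {ffun V -> W}) (f \in B i))); last first.
  by move=> i _; rewrite big_mkcond /=; apply: eq_bigr => f _; case: (f \in _).
rewrite exchange_big big_mkcond /= [X in _ <= X + _]big_mkcond -big_split.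
apply: leq_sum => f _ /=; rewrite !inE.
case: (boolP (choosing _ f)) => //= cf; case: (boolP (avoiding S f)) => //= af.
case: (boolP (avoiding _ f)) => // /allPn[i ie]; rewrite negb_imply negbK => /andP[si oi].
have vi : v \in supp i.
  apply: contraLR oi => vi; have /allP/(_ i ie)/implyP := af; apply.
  apply/subsetP => u ui; have := subsetP si u ui; rewrite !inE.
  by case: eqP => [uv|//]; rewrite -uv ui in vi.
by rewrite (big_rem i ie) /= vi si inE cf af oi.
Qed.


Local Open Scope ring_scope.
Hypothesis supp_neq0 : forall i, i \in evs -> supp i != set0.
Hypothesis c_gt0 : forall v, 0 < c v.
Hypothesis c_le : forall v,
  c v + \sum_(i <- evs | v \in supp i) \prod_(u in supp i :\ v) (c u)^-1
  <= #|choices v|%:R.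

(** Rosenfeld's induction: by [c_le], the extensions of a good function lost to events through [v]
    still leave a factor [c v]. *)
Lemma card_good_add n (S : {set V}) v : (#|S| <= n)%N -> v \notin S ->
  c v * #|good S|%:R <= #|good (v |: S)|%:R.
Proof.
elim/ltn_ind: n S v => n IH S v Sn vS.
(* Putting the elements of [Y] back one at a time multiplies the count by at least [c u] each time,
   by induction on the size of the set. *)
have IHD m (Y : {set V}) : (#|Y| <= m)%N -> Y \subset S ->
    #|good (S :\: Y)|%:R <= #|good S|%:R * \prod_(u in Y) (c u)^-1.
  elim: m Y => [|m IHm] Y Ym YS.
    by have -> : Y = set0; [apply/eqP; rewrite -cards_eq0; lia | rewrite setD0 big_set0 mulr1].
  have [->|[y yY]] := set_0Vmem Y; first by rewrite setD0 big_set0 mulr1.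
  have yS : y \in S := subsetP YS y yY.
  have YyS : Y :\ y \subset S by apply: subset_trans YS; apply: subsetDl.
  rewrite (cardsD1 y) yY in Ym; have IHY := IHm (Y :\ y) _ YyS.
  rewrite (big_setD1 y) //= mulrCA mulrC ler_pdivlMr // mulrC.
  apply: le_trans (IHY _); last by lia.
  have eqS : S :\: (Y :\ y) = y |: (S :\: Y).
    by apply/setP => u; rewrite !inE negb_and negbK; case: eqP => [->|].
  rewrite eqS; apply: (IH (#|S|.-1)) => //; last by rewrite !inE yY.
    by have := cardsD1 y S; rewrite yS; lia.
  have := subset_leq_card (setDS S (_ : [set y] \subset Y)); rewrite sub1set => /(_ yY).
  by have := cardsD1 y S; rewrite yS; lia.
have := card_good_step vS; rewrite -(ler_nat rat) natrM natrD natr_sum => step.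
have : #|good S|%:R * (c v + \sum_(i <- evs | v \in supp i) \prod_(u in supp i :\ v) (c u)^-1)
    <= #|good S|%:R * #|choices v|%:R by apply: ler_wpM2l.
move=> /le_trans/(_ step); rewrite mulrDr mulr_sumr [c v * _]mulrC.
suff: \sum_(i <- evs | (v \in supp i) && (supp i \subset v |: S))
        #|good (S :\: (supp i :\ v))|%:R <=
      \sum_(i <- evs | v \in supp i) #|good S|%:R * \prod_(u in supp i :\ v) (c u)^-1 by lra.
rewrite big_mkcondr; apply: ler_sum => i vi; case: ifP => [iS|_].
  apply: (IHD #|supp i :\ v|) => //; apply/subsetP => u; rewrite !inE => /andP[uv ui].
  by have := subsetP iS u ui; rewrite !inE (negPf uv).
by rewrite mulr_ge0 // prodr_ge0 // => u _; rewrite invr_ge0 ltW.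
Qed.

Lemma exists_avoiding : exists f : {ffun V -> W},
  (forall v, f v \in choices v) /\ {in evs, forall i, ~~ occurs i f}.
Proof.
have pos n (S : {set V}) : (#|S| <= n)%N -> 0 < #|good S|%:R :> rat.
  elim: n S => [|n IH] S Sn.
    have -> : S = set0 by apply/eqP; rewrite -cards_eq0; lia.
    rewrite ltr0n; apply/card_gt0P; exists [ffun=> w0]; rewrite inE; apply/andP; split.
      by apply/forallP => v; rewrite inE ffunE eqxx.
    (* On the empty set only an event with empty support could be tested, and [supp_neq0] excludes
       it. *)
    apply/allP => i ie; rewrite subset0 (negPf (supp_neq0 ie)) //.
  have [->|[y yS]] := set_0Vmem S; first by apply: IH; rewrite cards0.
  rewrite -(setD1K yS); have := cardsD1 y S; rewrite yS => cS.
  apply: lt_le_trans (@card_good_add #|S| _ _ _ _); last 2 first.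
  - by rewrite cS; lia.
  - by rewrite !inE eqxx.
  by rewrite mulr_gt0 // IH //; lia.
have := pos _ [set: V] (leqnn _); rewrite ltr0n => /card_gt0P[f]; rewrite inE.
case/andP => /forallP fv /allP fe; exists f; split=> [v|i /fe]; last by rewrite subsetT.
by have := fv v; rewrite inE.
Qed.

End Avoidance.

(** * Weighted closed walks *)

Section ClosedWalks.
Variables (V : finType) (e : rel V).
Local Open Scope ring_scope.

(** The step probability of the random walk leaving [u]; it is 0 when [u] has no successor. *)
Let w (u : V) : rat := #|[set y | e u y]|%:R^-1.

Let w_ge0 u : 0 <= w u. Proof. by rewrite invr_ge0. Qed.

Let w_le1 u : w u <= 1.
Proof.
rewrite /w; case: #|_| => [|n]; first by rewrite invr0.
by rewrite invf_le1 ?ler1n ?ltr0n.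
Qed.

(** The sum is the probability that the random walk from [v] survives [k] steps; mass is lost only
    at vertices without successors. *)
Lemma sum_walks k v :
  \sum_(t : k.-tuple V | path e v t) \prod_(u <- belast v t) w u <= 1.
Proof.
elim: k v => [|k IH] v.
  rewrite (bigD1 [tuple]) //= big_nil big1 ?addr0 // => t.
  by case/andP=> _ /eqP[]; apply: tuple0.
pose h (p : V * k.-tuple V) := cons_tuple p.1 p.2.
have hb : bijective h.
  exists (fun t : k.+1.-tuple V => (thead t, behead_tuple t)) => [[x t]|t].
    by rewrite /h /= theadE; congr (_, _); apply: val_inj.
  by rewrite /h; case/tupleP: t => x t; apply: val_inj; rewrite /= theadE.
rewrite (reindex h) /=; last exact: onW_bij.
rewrite (eq_bigl (fun p : V * k.-tuple V => e v p.1 && path e p.1 p.2)) //.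
under eq_bigr do rewrite big_cons.
rewrite -(pair_big_dep (e v) (fun y t => path e y (tval t))
  (fun y t => w v * \prod_(u <- belast y (tval t)) w u)) /=.
under eq_bigr do rewrite -mulr_sumr.
rewrite -mulr_sumr; apply: (@le_trans _ _ (w v * \sum_(y | e v y) 1)).
  by apply: ler_wpM2l => //; apply: ler_sum.
rewrite sumr_const /w cardsE.
by case: #|_| => [|n]; rewrite ?mulr0n ?mulr0 // mulVf // pnatr_eq0.
Qed.

(** Forgetting the closing arc leaves a walk from [v], and the weight of its last vertex is at most
    1. *)
Lemma sum_closed_walks_at l v :
  \sum_(t : l.+1.-tuple V | cycle e t && (thead t == v)) \prod_(u <- t) w u <= 1.
Proof.
apply: le_trans (sum_walks l v).
pose h (t : l.-tuple V) := cons_tuple v t.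
rewrite (reindex_onto h (fun t => behead_tuple t)) /=; last first.
  move=> t /andP[_]; case/tupleP: t => x t; rewrite theadE => /eqP xv.
  by apply: val_inj; rewrite /= xv.
rewrite big_mkcond [leRHS]big_mkcond; apply: ler_sum => t _.
case: ifP => [/andP[/andP[]]|_]; last first.
  by case: ifP => // _; apply: prodr_ge0 => u _; apply: w_ge0.
rewrite rcons_path => /andP[-> _] _ _; rewrite lastI -cats1 big_cat /= big_seq1.
by rewrite ler_piMr // prodr_ge0.
Qed.

(** A closed walk through [v] has [v] at one of [l] positions; rotating that position to the front
    reduces to walks based at [v]. *)
Lemma sum_closed_walks l v :
  \sum_(t : l.-tuple V | cycle e t && (v \in tval t)) \prod_(u <- t) w u <= l%:R.
Proof.
case: l => [|l]; first by rewrite big1 // => t; rewrite (tuple0 t) andbF.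
pose F j := \sum_(t : l.+1.-tuple V | cycle e t && (tnth t j == v)) \prod_(u <- t) w u.
have FE j : F j <= 1.
  apply: le_trans (sum_closed_walks_at l v).
  pose h (t : l.+1.-tuple V) := [tuple of rot j t].
  have hb : bijective h.
    exists (fun t : l.+1.-tuple V => [tuple of rotr j t]) => t; apply: val_inj => /=.
      exact: rotK.
    exact: rotrK.
  rewrite [leRHS](reindex h) /=; last exact: onW_bij.
  rewrite le_eqVlt; apply/orP; left; apply/eqP/eq_big => t; last first.
    by move=> _; apply: perm_big; rewrite perm_sym perm_rot.
  rewrite rot_cycle; congr (_ && (_ == v)).
  rewrite (tnth_nth v) /thead (tnth_nth v) /= nth0 /rot.
  by rewrite (drop_nth v) // size_tuple ltn_ord.
apply: (@le_trans _ _ (\sum_(j < l.+1) F j)); last first.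
  by apply: le_trans (ler_sum _ (fun j _ => FE j)) _; rewrite sumr_const card_ord.
rewrite /F (exchange_big_dep (fun t : l.+1.-tuple V => cycle e t)) /=;
  last by move=> j t _ /andP[].
rewrite big_mkcondr; apply: ler_sum => t ct.
case: ifP => [/tnthP[j ->]|_]; last by apply: sumr_ge0 => j _; apply: prodr_ge0.
rewrite (bigD1 j) ?ct ?eqxx //= lerDl; apply: sumr_ge0 => i _; exact: prodr_ge0.
Qed.

End ClosedWalks.

Lemma sum_closed_walks_rev (V : finType) (e : rel V) l v :
  (\sum_(t : l.-tuple V | cycle e t && (v \in tval t))
    \prod_(u <- t) (#|[set y | e y u]|%:R^-1 : rat) <= l%:R)%R.
Proof.
apply: le_trans (sum_closed_walks (fun x y => e y x) l v).
pose h (t : l.-tuple V) := [tuple of rev t].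
have hb : bijective h by exists h => t; apply: val_inj => /=; exact: revK.
rewrite [leRHS](reindex h) /=; last exact: onW_bij.
rewrite le_eqVlt; apply/orP; left; apply/eqP/eq_big => t; first by rewrite rev_cycle mem_rev.
by move=> _; apply: perm_big; rewrite perm_sym perm_rev.
Qed.

(** * Cycles in locally sparse digraphs *)

Ltac size_lia :=
  repeat match goal with H : is_true (leq _ _) |- _ => move: H end;
  repeat match goal with |- context [@size ?T ?s] => move: (@size T s) => ? end;
  lia.

Section SparseCycles.
Variables (V : finType) (e : rel V).
Hypothesis e_irr : irreflexive e.

Definition inner (X : {set V}) : {set V * V} :=
  [set a | [&& e a.1 a.2, a.1 \in X & a.2 \in X]].

Definition cycle_arcs (c : seq V) : {set V * V} :=
  [set (x, next c x) | x in [set x in c]].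

Lemma card_cycle_arcs c : uniq c -> #|cycle_arcs c| = size c.
Proof.
move=> uc; rewrite card_imset => [|x y [] //].
by rewrite cardsE (card_uniqP uc).
Qed.

Lemma cycle_arcs_inner c : cycle e c -> cycle_arcs c \subset inner [set x in c].
Proof.
move=> cc; apply/subsetP => _ /imsetP[x + ->]; rewrite !inE /= => xc.
by rewrite (next_cycle cc xc) mem_next xc.
Qed.

Lemma inner_subset (X Y : {set V}) : X \subset Y -> inner X \subset inner Y.
Proof.
move=> /subsetP XY; apply/subsetP => a; rewrite !inE => /and3P[-> /XY -> /XY ->] //.
Qed.

Lemma set_nil : [set x in [::]] = set0 :> {set V}.
Proof. by apply/setP => x; rewrite !inE. Qed.

(** Each new vertex on the path brings along the arc by which it is reached. *)
Lemma inner_path (X : {set V}) u p : u \in X -> path e u p ->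
  #|X| <= #|inner X| -> #|X :|: [set x in p]| <= #|inner (X :|: [set x in p])|.
Proof.
elim: p X u => [|y p IH] X u uX /=; first by rewrite set_nil setU0.
move=> /andP[uy py] Xi.
have -> : X :|: [set x in y :: p] = (y |: X) :|: [set x in p].
  by apply/setP => z; rewrite !inE; case: (z \in X); rewrite ?orbT //= orbF.
apply: (IH _ y) => //; first by rewrite !inE eqxx.
case: (boolP (y \in X)) => yX; first by rewrite (setUidPr _) // sub1set.
rewrite cardsU1 yX; apply: (@leq_trans #|(u, y) |: inner X|).
  by rewrite cardsU1 !inE /= (negPf yX) !andbF.
apply/subset_leq_card; rewrite subUset sub1set inner_subset ?subsetUr //.
by rewrite !inE /= uy uX eqxx orbT.
Qed.

Lemma exists_next_notin (c : seq V) (Y : {set V}) z y : uniq c ->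
  z \in c -> z \in Y -> y \in c -> y \notin Y ->
  exists2 x, x \in c & (x \in Y) && (next c x \notin Y).
Proof.
move=> uc zc zY yc yY.
case: (boolP (has (fun x => (x \in Y) && (next c x \notin Y)) c)) => [/hasP//|/hasPn no].
case/negP: yY; have /iter_findex <- : fconnect (next c) z y.
  by rewrite (fconnect_cycle (cycle_next uc)).
elim: findex => //= k; set x := iter _ _ _ => xY; have := no x.
rewrite xY negbK; apply.
by rewrite /x; elim: k {xY x} => //= k; rewrite mem_next.
Qed.

(** Each new vertex brings its outgoing cycle arc, and the arc by which the cycle leaves [Y] is one
    more. *)
Lemma inner_cycle_gain (Y : {set V}) c z y : ucycle e c ->
  z \in c -> z \in Y -> y \in c -> y \notin Y -> #|Y| <= #|inner Y| ->
  #|Y :|: [set x in c]| < #|inner (Y :|: [set x in c])|.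
Proof.
case/andP=> cc uc zc zY yc yY Yi.
have [x xc /andP[xY nxY]] := exists_next_notin uc zc zY yc yY.
pose N := [set (u, next c u) | u in [set u in c] :\: Y].
have cN : #|N| = #|[set u in c] :\: Y| by rewrite card_imset // => ? ? [].
have sub : (x, next c x) |: (inner Y :|: N) \subset inner (Y :|: [set x in c]).
  apply/subsetP => a; rewrite !inE => /orP[/eqP -> /=|/orP[/and3P[-> -> ->]|]] //=.
    by rewrite mem_next xc (next_cycle cc xc) !orbT.
  move=> /imsetP[u + ->]; rewrite !inE /= => /andP[_ uc'].
  by rewrite mem_next uc' (next_cycle cc uc') !orbT.
apply: leq_trans (subset_leq_card sub).
rewrite cardsU1 !cardsU cN.
have -> : inner Y :&: N = set0.
  apply/setP => a; rewrite !inE; apply/negP => /andP[/and3P[_ a1 _] /imsetP[u]].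
  by rewrite !inE => /andP[uY _] au; rewrite au (negPf uY) in a1.
have -> : (x, next c x) \notin inner Y :|: N.
  rewrite !inE /= (negPf nxY) !andbF /=; apply/imsetP => -[u].
  by rewrite !inE => /andP[uY _] [xu _]; rewrite -xu xY in uY.
rewrite cards0 subn0 cardsD [[set x in c] :&: Y]setIC /= add1n ltnS.
by rewrite -addnBA ?subset_leq_card ?subsetIr // leq_add2r.
Qed.

Variable K0 : nat.
Hypothesis sparse : forall X : {set V}, #|X| <= K0 -> #|inner X| <= #|X|.

Lemma inner_ucycle c : ucycle e c -> #|[set x in c]| <= #|inner [set x in c]|.
Proof.
case/andP=> cc uc; apply: leq_trans (subset_leq_card (cycle_arcs_inner cc)).
by rewrite card_cycle_arcs // cardsE card_size.
Qed.

Lemma card_seq (c : seq V) : #|[set x in c]| <= size c.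
Proof. by rewrite cardsE card_size. Qed.

Lemma card_seqU (Y : {set V}) (c : seq V) : #|Y :|: [set x in c]| <= #|Y| + size c.
Proof. by apply: leq_trans (leq_card_setU _ _) _; rewrite leq_add2l card_seq. Qed.

(** Otherwise [inner_cycle_gain] makes the union of the two cycles too dense. *)
Lemma overlap_sub c0 c1 z : ucycle e c0 -> ucycle e c1 ->
  size c0 + size c1 <= K0 -> z \in c0 -> z \in c1 -> {subset c1 <= c0}.
Proof.
move=> u0 u1 s01 z0 z1 y y1; apply: contraT => y0.
have : #|[set x in c0] :|: [set x in c1]| < #|inner ([set x in c0] :|: [set x in c1])|.
  by apply: (@inner_cycle_gain _ _ z y); rewrite ?inE //; apply: inner_ucycle.
rewrite ltnNge sparse //; apply: leq_trans (card_seqU _ _) _.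
by apply: leq_trans s01; rewrite leq_add2r card_seq.
Qed.

(** Both cycles have the same vertex set, and sparsity leaves no room there for arcs other than
    those of one cycle. *)
Lemma overlap_arcs c0 c1 z : ucycle e c0 -> ucycle e c1 ->
  size c0 + size c1 <= K0 -> z \in c0 -> z \in c1 -> cycle_arcs c0 = cycle_arcs c1.
Proof.
move=> u0 u1 s01 z0 z1.
have s10 : size c1 + size c0 <= K0 by lia.
have c01 : [set x in c0] = [set x in c1].
  apply/setP => x; rewrite !inE; apply/idP/idP.
    exact: (overlap_sub u1 u0 s10 z1 z0).
  exact: (overlap_sub u0 u1 s01 z0 z1).
have arcsE c : ucycle e c -> size c <= K0 -> cycle_arcs c = inner [set x in c].
  case/andP=> cc uc sc; apply/eqP; rewrite eqEcard cycle_arcs_inner //=.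
  rewrite card_cycle_arcs //; apply: leq_trans (card_seq c).
  by apply: sparse; apply: leq_trans (card_seq c) _.
by rewrite !arcsE //; [rewrite c01 | lia | lia].
Qed.

Lemma mem_cycle_arcs c x y : uniq c ->
  ((x, y) \in cycle_arcs c) = (x \in c) && (y == next c x).
Proof.
move=> uc; apply/imsetP/andP => [[u + [-> ->]]|[xc /eqP ->]]; first by rewrite inE.
by exists x; rewrite ?inE.
Qed.

(** All short cycles through [z] make the same transition at [z], so a single choice of shift can
    break them all. *)
Lemma overlap_next c0 c1 z : ucycle e c0 -> ucycle e c1 ->
  size c0 + size c1 <= K0 -> z \in c0 -> z \in c1 ->
  next c0 z = next c1 z /\ prev c0 z = prev c1 z.
Proof.
move=> u0 u1 s01 z0 z1; have E := overlap_arcs u0 u1 s01 z0 z1.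
have [un0 un1] : uniq c0 /\ uniq c1 by case/andP: u0; case/andP: u1.
split.
  have : (z, next c0 z) \in cycle_arcs c1 by rewrite -E mem_cycle_arcs // z0 eqxx.
  by rewrite mem_cycle_arcs // => /andP[_ /eqP].
have : (prev c0 z, z) \in cycle_arcs c1.
  by rewrite -E mem_cycle_arcs // mem_prev z0 (next_prev un0) eqxx.
by rewrite mem_cycle_arcs // => /andP[_ /eqP E']; rewrite [in RHS]E' (prev_next un1).
Qed.

Lemma ucycle_size_gt1 c x : ucycle e c -> x \in c -> exists2 y, y \in c & y != x.
Proof.
case/andP=> cc uc xc; exists (next c x); first by rewrite mem_next.
by apply: contraTneq (next_cycle cc xc) => ->; rewrite e_irr.
Qed.

(** The cycle [c0] with the path up to its first vertex on [c1] has as many arcs as vertices; a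
    disjoint [c1] would then add a surplus arc. *)
Lemma no_path_between c0 c1 u p : ucycle e c0 -> ucycle e c1 ->
  size c0 + size c1 + size p <= K0 -> u \in c0 -> path e u p ->
  has (mem c1) p -> has (mem c1) c0.
Proof.
move=> u0 u1 sz uc0 + hp; case: (split_find hp) sz => y p1 p2 yc1 p1c1.
rewrite size_cat cat_path => sz /andP[pp _]; apply: contraT => c01.
pose Y := [set x in c0] :|: [set x in rcons p1 y].
(* A second vertex of [c1] is needed outside [Y]; it exists because there are no loops. *)
have [y' y'c1 y'y] := ucycle_size_gt1 u1 yc1.
have : #|Y :|: [set x in c1]| < #|inner (Y :|: [set x in c1])|.
  apply: (@inner_cycle_gain _ _ y y') => //.
  - by rewrite !inE mem_rcons mem_head orbT.
  - rewrite !inE mem_rcons inE (negPf y'y) /= negb_or; apply/andP; split.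
      by apply: contra c01 => y'c0; apply/hasP; exists y'.
    by apply: contra p1c1 => y'p; apply/hasP; exists y'.
  - by apply: (inner_path (u := u)); rewrite ?inE // inner_ucycle.
rewrite ltnNge sparse //; apply: leq_trans (card_seqU _ _) _.
apply: (@leq_trans (size c0 + size (rcons p1 y) + size c1)); last first.
  by apply: leq_trans sz; rewrite addnAC addnA leq_addr.
rewrite leq_add2r; apply: leq_trans (card_seqU _ _) _; by rewrite leq_add2r card_seq.
Qed.

Variable L : nat.

Definition special (v : V) : bool :=
  `[< exists c, [/\ ucycle e c, size c <= L & v \in c] >].

(** All special vertices of a short path lie on the short cycle through the first of them. *)
Lemma count_special_window K w : K + L + L <= K0 -> sorted e w ->
  uniq w -> size w <= K -> count special w <= L.
Proof.
move=> KL sw uw szw.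
case: (boolP (has special w)) => [hs|]; last first.
  by rewrite has_count -leqNgt leqn0 => /eqP ->.
case: (split_find hs) sw uw szw => u s1 s2 /asboolP[c0 [u0 sz0 uc0]] /hasPn s1n.
rewrite cat_rcons => /cat_sorted2[_ /= pu] uw szw.
rewrite -size_filter; apply: (leq_trans _ sz0); apply: uniq_leq_size.
  by rewrite filter_uniq.
move=> v; rewrite mem_filter mem_cat inE => /andP[sv].
case/orP=> [/s1n|]; first by rewrite sv.
case/orP=> [/eqP -> //|vs2]; case/asboolP: sv => c1 [u1 sz1 vc1].
have /hasP[z z0 z1] : has (mem c1) c0.
  apply: (no_path_between u0 u1 _ uc0 pu).
    by move: szw; rewrite size_cat /=; size_lia.
  by apply/hasP; exists v.
by apply: (overlap_sub u0 u1 _ z0 z1) => //; size_lia.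
Qed.

Lemma count_special_path K w : 0 < K -> K + L + L <= K0 -> sorted e w ->
  uniq w -> count special w <= L * (size w %/ K).+1.
Proof.
move=> K0' KL; have [n] := ubnP (size w); elim: n w => // n IH w swn sw uw.
case: (leqP (size w) K) => [swK|Kw].
  by apply: leq_trans (count_special_window KL sw uw swK) _; rewrite leq_pmulr.
rewrite -(cat_take_drop K w) count_cat.
have [s1 s2] : sorted e (take K w) /\ sorted e (drop K w).
  by move: sw; rewrite -{1}(cat_take_drop K w) => /cat_sorted2[].
have := count_special_window KL s1 (take_uniq K uw); rewrite size_take Kw => /(_ (leqnn _)).
have := IH (drop K w) _ s2 (drop_uniq K uw); rewrite size_drop => /(_ _)/[dup].
rewrite cat_take_drop.
have -> : size w %/ K = ((size w - K) %/ K).+1.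
  by rewrite -{1}(subnK (ltnW Kw)) divnDr // divnn K0' addn1.
by rewrite mulnS => h _; have := h _; lia.
Qed.

(** A cycle longer than [L] but of length at most [K] has no special vertex, since it would be
    contained in a short cycle. A longer one fills at least one window, so the rounding-up in
    [count_special_path] is absorbed by the factor 2. *)
Lemma count_special_cycle K x s : 0 < K -> K + L + L <= K0 -> ucycle e (x :: s) ->
  L < size (x :: s) -> count special s <= (2 * L) * (size s %/ K).
Proof.
move=> K_gt0 KL uc Ls; case: (leqP (size (x :: s)) K) => [sK|Ks].
  apply: (@leq_trans 0) => //; rewrite leqn0 -leqn0 leqNgt -has_count.
  apply/hasPn => v vs; apply/asboolP => -[c [ucc szc vc]].
  have vxs : v \in x :: s by rewrite inE vs orbT.
  have uni : uniq (x :: s) by case/andP: uc.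
  have := uniq_leq_size uni (overlap_sub ucc uc _ vc vxs); lia.
have /andP[cxs /= /andP[xs us]] := uc.
have ss : sorted e s.
  by move: cxs; rewrite /= rcons_path => /andP[/path_sorted].
apply: leq_trans (count_special_path K_gt0 KL ss us) _.
have : 0 < size s %/ K by rewrite divn_gt0 //; move: Ks => /=; lia.
by nia.
Qed.

End SparseCycles.

(** * Decompositions from transitions *)

Section Transitions.
Variables (V : finType) (e : rel V).

Definition outs v := [set y | e v y].
Definition ins v := [set y | e y v].
Definition maxdeg v := maxn #|outs v| #|ins v|.

(** Reducing modulo the larger degree gives a partial injection that saturates the smaller side. *)
Definition matched (s : nat) (a v b : V) : bool :=
  [&& e a v, e v b &
    (index a (enum (ins v)) + s) %% maxdeg v == index b (enum (outs v))].

Lemma index_enum_inj (A : {set V}) x y : x \in A -> y \in A ->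
  index x (enum A) = index y (enum A) -> x = y.
Proof.
move=> xA yA E; have <- : nth x (enum A) (index x (enum A)) = x by rewrite nth_index ?mem_enum.
by rewrite E nth_index ?mem_enum.
Qed.

Lemma index_ins a v : e a v -> index a (enum (ins v)) < #|ins v|.
Proof. by move=> av; rewrite cardE index_mem mem_enum inE. Qed.

Lemma index_outs b v : e v b -> index b (enum (outs v)) < #|outs v|.
Proof. by move=> vb; rewrite cardE index_mem mem_enum inE. Qed.

Lemma matched_out_inj s a v b b' : matched s a v b -> matched s a v b' -> b = b'.
Proof.
case/and3P=> _ vb /eqP E /and3P[_ vb' /eqP]; rewrite E => bb'.
by apply: (@index_enum_inj (outs v)); rewrite ?inE.
Qed.

Lemma matched_in_inj s a a' v b : matched s a v b -> matched s a' v b -> a = a'.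
Proof.
case/and3P=> av _ /eqP E /and3P[a'v _ /eqP]; rewrite -E => /eqP.
rewrite eqn_modDr !modn_small => [/eqP aa'||].
- by apply: (@index_enum_inj (ins v)); rewrite ?inE.
- by apply: leq_trans (index_ins av) _; rewrite leq_maxr.
- by apply: leq_trans (index_ins a'v) _; rewrite leq_maxr.
Qed.

(** Only one of the [maxdeg v] shifts realises a given transition: this is the probability 1/m of
    the local-lemma argument. *)
Lemma matched_shift_inj s s' a v b : s < maxdeg v -> s' < maxdeg v ->
  matched s a v b -> matched s' a v b -> s = s'.
Proof.
move=> sm s'm /and3P[_ _ /eqP E] /and3P[_ _]; rewrite -E eq_sym.
by rewrite eqn_modDl !modn_small // => /eqP.
Qed.

(** If out-arcs are no more numerous than in-arcs, all of them are matched; otherwise the in-arcs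
    are matched to distinct out-arcs. *)
Lemma card_unmatched s v :
  #|[set b in outs v | [forall a, ~~ matched s a v b]]| <= #|outs v| - #|ins v|.
Proof.
set U := [set _ in _ | _].
have US : U \subset outs v by apply/subsetP => b; rewrite inE => /andP[].
case: (leqP #|outs v| #|ins v|) => [pq|qp].
  rewrite (eqP (_ : _ - _ == 0)) ?subn_eq0 // leqn0 cards_eq0; apply/eqP/setP => b.
  rewrite !inE; apply/negP => /andP[vb /forallP no].
  have m : maxdeg v = #|ins v| by apply/maxn_idPr.
  have m0 : 0 < #|ins v| by apply: leq_ltn_trans (leq_trans (index_outs vb) pq).
  (* The solution of [i + s = index b] modulo [maxdeg v], written so that the truncated subtraction
     is exact. *)
  set i := (index b (enum (outs v)) + (maxdeg v - s %% maxdeg v)) %% maxdeg v.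
  have im : i < #|ins v| by rewrite /i m ltn_mod.
  have ia : nth v (enum (ins v)) i \in ins v by rewrite -mem_enum mem_nth // -cardE.
  have /negP[] := no (nth v (enum (ins v)) i); rewrite /matched vb.
  rewrite inE in ia; rewrite ia /= index_uniq ?enum_uniq -?cardE //.
  rewrite /i modnDml -addnA -modnDmr.
  have -> : (maxdeg v - s %% maxdeg v + s) %% maxdeg v = 0.
    rewrite -modnDmr subnK ?modnn //; apply: ltnW; rewrite ltn_mod m //.
  by rewrite addn0 modn_small // m; apply: leq_trans (index_outs vb) pq.
have m : maxdeg v = #|outs v| by apply/maxn_idPl/ltnW.
pose g a := nth v (enum (outs v)) ((index a (enum (ins v)) + s) %% maxdeg v).
have gP a : a \in ins v -> matched s a v (g a).
  rewrite inE => av; have im : (index a (enum (ins v)) + s) %% maxdeg v < #|outs v|.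
    by rewrite m ltn_mod; apply: leq_ltn_trans qp.
  have : g a \in outs v by rewrite -mem_enum mem_nth // -cardE.
  by rewrite inE /matched av => -> /=; rewrite index_uniq ?enum_uniq // -cardE.
have : g @: ins v \subset outs v :\: U.
  apply/subsetP => _ /imsetP[a ai ->]; have ga := gP a ai; rewrite !inE.
  have /and3P[_ -> _] := ga; rewrite andbT /=.
  by apply/forallPn; exists a; rewrite negbK.
move/subset_leq_card; rewrite card_in_imset => [|a a' ai a'i gaa]; last first.
  by have := gP a ai; rewrite gaa => /matched_in_inj/(_ (gP a' a'i)).
rewrite cardsD (setIidPr US) => h.
have := subset_leq_card US; move: h; move: #|U| => u; lia.
Qed.

Variable f : V -> nat.
Hypothesis e_irr : irreflexive e.

Definition trail x0 (l : seq V) := forall i, i.+2 < size l ->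
  matched (f (nth x0 l i.+1)) (nth x0 l i) (nth x0 l i.+1) (nth x0 l i.+2).

(** The vertex [x] is exempt because a trail that closes up at [x] may begin and end there without
    making the transition. *)
Hypothesis broken : forall x s, ucycle e (x :: s) ->
  exists2 u, u \in s & ~~ matched (f u) (prev (x :: s) u) u (next (x :: s) u).

(** By induction the tail has no repetition. If the head [x] recurs, the part before its recurrence
    is a cycle followed at every vertex but [x], against [broken]. *)
Lemma trail_uniq x0 l : sorted e l -> trail x0 l -> uniq l.
Proof.
elim: l => // x l IH pl tl.
have ul : uniq l.
  apply: IH => [|i il]; first exact: path_sorted pl.
  exact: (tl i.+1).
rewrite cons_uniq ul andbT; apply/negP => xl.
case/splitPr: l / xl pl tl ul {IH} => s1 s2 pl tl ul.
have us : uniq (x :: s1).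
  by move: ul; rewrite cat_uniq => /and3P[us /= /norP[xs _] _]; rewrite us xs.
have cyc : ucycle e (x :: s1).
  apply/andP; split=> //=; rewrite rcons_path.
  by move: pl; rewrite /= cat_path => /and3P[-> -> _].
have [u us1] := broken cyc; case/negP.
have ux : u != x by apply: contraTneq us1 => ->; case/andP: us.
have uc : u \in x :: s1 by rewrite inE us1 orbT.
have is1 : index u s1 < size s1 by rewrite index_mem.
have := tl (index u s1).
have -> : nth x0 (x :: s1 ++ x :: s2) (index u s1) = prev (x :: s1) u.
  rewrite prev_nth uc -cat_cons nth_cat /= ltnS (ltnW is1).
  by apply: set_nth_default; rewrite /= ltnS ltnW.
have -> : nth x0 (x :: s1 ++ x :: s2) (index u s1).+1 = u.
  by rewrite /= nth_cat is1 nth_index.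
(* If [u] ends [s1], the cyclic successor wraps around to [x], which is also the next entry of the
   list. *)
have -> : nth x0 (x :: s1 ++ x :: s2) (index u s1).+2 = next (x :: s1) u.
  rewrite next_nth uc /= [x == u]eq_sym (negPf ux) nth_cat.
  case: ltnP => lt; first exact: set_nth_default.
  have -> : (index u s1).+1 = size s1 by apply/eqP; rewrite eqn_leq is1 lt.
  by rewrite subnn [RHS]nth_default.
by apply; rewrite /= size_cat /= addnS !ltnS (leq_trans is1) ?leq_addr.
Qed.

End Transitions.

(** * Paths obtained by following the transitions *)

Section TransitionPaths.
Variables (V : finType) (D : digraph V) (f : V -> nat).
Let e := [rel x y | (x, y) \in arcs D].

Lemma arcs_irr : irreflexive e.
Proof. by move=> x; case: D @e => A /= /forallP/(_ x)/negPf. Qed.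

Hypothesis broken : forall x s, ucycle e (x :: s) ->
  exists2 u, u \in s & ~~ matched e (f u) (prev (x :: s) u) u (next (x :: s) u).

Definition link : rel (V * V) :=
  [rel a b | (a.2 == b.1) && matched e (f a.2) a.1 a.2 b.2].

Definition vertices (a : V * V) (c : seq (V * V)) := a.1 :: a.2 :: map snd c.

Lemma link_arcs a b : link a b -> b \in arcs D.
Proof. by case: a b => [a1 a2] [b1 b2] /= /andP[/eqP -> /and3P[]]. Qed.

Lemma link_fun a b b' : link a b -> link a b' -> b = b'.
Proof.
case: a b b' => [a1 a2] [b1 b2] [b1' b2'] /andP[/= /eqP <- m] /andP[/= /eqP <- m'].
by rewrite (matched_out_inj m m').
Qed.

Lemma link_inj a a' b : link a b -> link a' b -> a = a'.
Proof.
case: a a' b => [a1 a2] [a1' a2'] [b1 b2] /andP[/= /eqP -> m] /andP[/= /eqP -> m'].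
by rewrite (matched_in_inj m m').
Qed.

Lemma zip_vertices a c : path link a c -> zip (vertices a c) (behead (vertices a c)) = a :: c.
Proof.
case: a => a1 a2; rewrite /vertices /=; elim: c a1 a2 => //= [[b1 b2]] c IH a1 a2.
by case/andP=> /andP[/= /eqP -> _] pc; rewrite (IH _ _ pc).
Qed.

Lemma vertices_uniq a c : a \in arcs D -> path link a c -> uniq (vertices a c).
Proof.
move=> aD pc; suff tr : forall x0, trail e f x0 (vertices a c).
  apply: (trail_uniq broken _ (tr a.1)) => {tr}.
  case: a aD pc => a1 a2 /=; rewrite /vertices /= => -> /=.
  elim: c a1 a2 => //= [[b1 b2]] c IH a1 a2 /andP[ab pc]; rewrite (IH _ _ pc) andbT.
  by have := link_arcs ab; case/andP: ab => /= /eqP <-.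
move=> x0; elim: c a pc {aD} => [|b c IH] a //= /andP[ab pc] [|i] ic.
  by case/andP: ab.
by have /andP[/eqP ab1 _] := ab; have := IH b pc i ic; rewrite /vertices -ab1.
Qed.

(** Distinctness of the vertices bounds every chain of links, so extending a chain forwards or
    backwards must stop. *)
Lemma size_path_link a c : a \in arcs D -> path link a c -> size c < #|V|.
Proof.
move=> aD pc; have /card_uniqP := vertices_uniq aD pc.
by move: (max_card (mem (vertices a c))) => /[swap] -> /=; rewrite size_map; apply: leq_trans.
Qed.

Lemma exists_maximal_path a : a \in arcs D ->
  exists2 c, path link a c & forall b, ~~ link (last a c) b.
Proof.
move=> aD.
have : forall k, (exists2 c, path link a c & size c = k) \/
    exists2 c, path link a c & forall b, ~~ link (last a c) b.
  elim=> [|k [[c pc sc]|]]; [by left; exists [::] | | by right].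
  case: (pickP (link (last a c))) => [b lb|no].
    by left; exists (rcons c b); rewrite ?rcons_path ?pc ?size_rcons ?sc.
  by right; exists c => // b; rewrite no.
by case/(_ #|V|) => // -[c pc sc]; have := size_path_link aD pc; rewrite sc ltnn.
Qed.

Definition starts := [set a in arcs D | [forall b, ~~ link b a]].

Lemma exists_start a : a \in arcs D -> exists2 b, b \in starts & connect link b a.
Proof.
move=> aD.
have : forall k, (exists b c, [/\ b \in arcs D, path link b c, last b c = a & size c = k]) \/
    exists2 b, b \in starts & connect link b a.
  elim=> [|k [[b [c [bD pc lc sc]]]|]]; [by left; exists a, [::] | | by right].
  case: (pickP (link^~ b)) => [b' lb|no]; last first.
    right; exists b; last by apply/connectP; exists c.
    by rewrite inE bD; apply/forallP => b'; rewrite no.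
  case: (boolP (b' \in arcs D)) => b'D; last first.
    by case/negP: b'D; case/andP: lb => _ /and3P[]; case: (b').
  by left; exists b', (b :: c); rewrite /= lb pc sc.
by case/(_ #|V|) => // -[b [c [bD pc lc sc]]]; have := size_path_link bD pc; rewrite sc ltnn.
Qed.

(** By [link_inj] two chains into [b] agree when read backwards, and neither can continue beyond a
    start. *)
Lemma connect_start_inj a a' b : a \in starts -> a' \in starts ->
  connect link a b -> connect link a' b -> a = a'.
Proof.
rewrite !inE => /andP[_ /forallP sa] /andP[_ /forallP sa'] /connectP[p pp ->].
case/connectP=> p'; elim/last_ind: p p' pp => [|p x IH] p'; case/lastP: p' => [|p' x'] //=.
- by move=> _; rewrite rcons_path last_rcons => /andP[_ +] ax; rewrite -ax (negPf (sa _)).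
- by rewrite rcons_path last_rcons => /andP[_ +] _ xa'; rewrite xa' (negPf (sa' _)).
rewrite !rcons_path !last_rcons => /andP[pp lx] /andP[pp' lx'] xx'.
by rewrite -xx' in lx'; apply: (IH p') => //; exact: link_inj lx lx'.
Qed.

Definition chain a := [set b | connect link a b].

Lemma mem_chain a c b : path link a c -> (forall b, ~~ link (last a c) b) ->
  (b \in chain a) = (b \in a :: c).
Proof.
move=> pc stuck; rewrite inE; apply/connectP/idP => [[p pp ->]|bc]; last first.
  by have := path_connect pc bc => /connectP[p]; exists p.
elim: c a p pc stuck pp => [|x c IH] a [|y p] //=; rewrite ?mem_head //.
  by move=> _ no /andP[ay]; rewrite (negPf (no y)) in ay.
move=> /andP[ax pc] no /andP[ay pp]; rewrite (link_fun ay ax) in pp *.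
by rewrite inE (IH _ p pc no pp) orbT.
Qed.

(** Every arc lies on the chain of exactly one start, and a chain visits distinct vertices. *)
Lemma starts_decomposition : path_decomposition D (chain @: starts).
Proof.
have sD a : a \in starts -> a \in arcs D by rewrite inE => /andP[].
have memD a b : a \in arcs D -> b \in chain a -> b \in arcs D.
  move=> aD; rewrite inE => /connectP[p pp ->].
  by elim: p a aD pp => //= x p IH a aD /andP[/link_arcs xD]; apply: IH.
split; last first.
  move=> _ /imsetP[a /sD aD ->]; have [c pc no] := exists_maximal_path aD.
  exists (vertices a c); first exact: vertices_uniq.
  by apply/setP => b; rewrite (mem_chain _ pc no) zip_vertices // [RHS]inE.
apply/and3P; split.
- rewrite cover_imset; apply/eqP/setP => b; apply/bigcupP/idP => [[a /sD aD]|bD].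
    exact: memD.
  by have [a sa ab] := exists_start bD; exists a => //; rewrite inE.
- apply/trivIsetP => _ _ /imsetP[a sa ->] /imsetP[a' sa' ->] neq.
  rewrite -setI_eq0; apply/negPn/negP => /set0Pn[b]; rewrite !inE => /andP[ab a'b].
  by case/eqP: neq; rewrite (connect_start_inj sa sa' ab a'b).
- by apply/imsetP => -[a _ /setP/(_ a)]; rewrite !inE connect0.
Qed.

(** The starts leaving [v] are its unmatched out-arcs; the subtraction is truncated at 0. *)
Lemma card_starts : #|starts| <= \sum_v (outdeg D v - indeg D v).
Proof.
rewrite -sum1_card (partition_big fst predT) //=; apply: leq_sum => v _.
rewrite -[outdeg D v]/#|outs e v| -[indeg D v]/#|ins e v|.
apply: leq_trans (card_unmatched e (f v) v).
rewrite sum1dep_card; apply: leq_trans (leq_imset_card (pair v) _).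
apply/subset_leq_card/subsetP => -[x y]; rewrite !inE /=.
case/andP=> /andP[xyD /forallP no] /eqP xv.
apply/imsetP; exists y; last by rewrite xv.
rewrite !inE /= -xv xyD; apply/forallP => a.
by have := no (a, x); rewrite /link /= eqxx.
Qed.

End TransitionPaths.

(** * The excess as a lower bound for path decompositions *)

Section Excess.
Variables (V : finType) (D : digraph V).
Local Open Scope ring_scope.

(** In this form the degrees split over the blocks of a partition of the arcs. *)
Lemma outdegE v : outdeg D v = (\sum_(a in arcs D) (a.1 == v))%N.
Proof.
rewrite -big_mkcondr /= sum1dep_card /outdeg.
rewrite -(card_imset _ (_ : injective (pair v))) => [|x y []//].
apply: eq_card => -[x y]; rewrite !inE /=; apply/imsetP/andP => [[z + [-> ->]]|[xy /eqP <-]].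
  by rewrite inE eqxx.
by exists y; rewrite ?inE.
Qed.

Lemma indegE v : indeg D v = (\sum_(a in arcs D) (a.2 == v))%N.
Proof.
rewrite -big_mkcondr /= sum1dep_card /indeg.
rewrite -(card_imset _ (_ : injective (pair^~ v))) => [|x y []//].
apply: eq_card => -[x y]; rewrite !inE /=; apply/imsetP/andP => [[z + [-> ->]]|[xy /eqP <-]].
  by rewrite inE eqxx.
by exists x; rewrite ?inE.
Qed.

Lemma sum_outdeg : (\sum_v outdeg D v = #|arcs D|)%N.
Proof.
under eq_bigr do rewrite outdegE; rewrite exchange_big -sum1_card; apply: eq_bigr => a _.
by rewrite (bigD1 a.1) //= eqxx big1 // => v; rewrite eq_sym => /negPf ->.
Qed.

Lemma sum_indeg : (\sum_v indeg D v = #|arcs D|)%N.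
Proof.
under eq_bigr do rewrite indegE; rewrite exchange_big -sum1_card; apply: eq_bigr => a _.
by rewrite (bigD1 a.2) //= eqxx big1 // => v; rewrite eq_sym => /negPf ->.
Qed.

(** The imbalances sum to 0, so half the sum of their absolute values equals the sum of their
    positive parts. *)
Lemma excessE : excess D = (\sum_v (outdeg D v - indeg D v)%N)%:R.
Proof.
have : \sum_v ((outdeg D v)%:R - (indeg D v)%:R : rat) = 0.
  by rewrite big_split /= sumrN -!natr_sum sum_outdeg sum_indeg subrr.
rewrite /excess natr_sum => E.
rewrite (eq_bigr (fun v => 2 * (outdeg D v - indeg D v)%:R -
   ((outdeg D v)%:R - (indeg D v)%:R))) => [|v _].
  by rewrite big_split /= sumrN E subr0 -mulr_sumr mulrA mulVf // mul1r.
case: (leqP (indeg D v) (outdeg D v)) => h.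
  by rewrite ger0_norm ?subr_ge0 ?ler_nat // natrB //; ring.
have -> : (outdeg D v - indeg D v)%N = 0%N by apply/eqP; rewrite subn_eq0 ltnW.
by rewrite ltr0_norm ?subr_lt0 ?ltr_nat // mulr0 sub0r.
Qed.

Lemma unzip1_zip_belast (x : V) s : unzip1 (zip (x :: s) s) = belast x s.
Proof. by elim: s x => //= y s IH x; rewrite -IH. Qed.

(** Only the two ends of a path are unbalanced, each by one. *)
Lemma path_excess (P : {set V * V}) : dipath P ->
  \sum_v `|(\sum_(a in P) (a.1 == v))%N%:R - (\sum_(a in P) (a.2 == v))%N%:R : rat| <= 2.
Proof.
case=> -[|x s] us ->.
  by rewrite big1 // => v _; rewrite !big1 ?subrr ?normr0 // => a; rewrite inE.
have uz : uniq (zip (x :: s) s) by apply: zip_uniqr; case/andP: us.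
have E v : (\sum_(a in [set e in zip (x :: s) (behead (x :: s))]) (a.1 == v))%N%:R -
           (\sum_(a in [set e in zip (x :: s) (behead (x :: s))]) (a.2 == v))%N%:R =
           (x == v)%:R - (last x s == v)%:R :> rat.
  have cnt (g : V * V -> V) : (\sum_(a in [set e in zip (x :: s) s]) (g a == v) =
      count_mem v (map g (zip (x :: s) s)))%N.
    rewrite (eq_bigl (fun a => a \in zip (x :: s) s)) => [|a]; last by rewrite inE.
    by rewrite -(big_uniq _ uz) -sum1_count big_map [RHS]big_mkcond.
  rewrite [behead _]/= (cnt fst) (cnt snd).
  rewrite [map fst _]unzip1_zip_belast [map snd _]unzip2_zip //=.
  have : (count_mem v (x :: s) = count_mem v (rcons (belast x s) (last x s)))%N.
    by rewrite -lastI.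
  rewrite -cats1 count_cat /= addn0 => /(congr1 (fun n => n%:R : rat)).
  by rewrite !natrD; lra.
under eq_bigr do rewrite E.
apply: (@le_trans _ _ (\sum_v ((x == v)%:R + (last x s == v)%:R))).
  by apply: ler_sum => v _; apply: le_trans (ler_normB _ _) _; rewrite !ger0_norm.
have one y : \sum_v (y == v)%:R = 1 :> rat.
  by rewrite (bigD1 y) //= eqxx big1 ?addr0 // => v; rewrite eq_sym => /negPf ->.
by rewrite big_split /= !one.
Qed.

Lemma excess_le (F : {set {set V * V}}) : path_decomposition D F ->
  excess D <= #|F|%:R.
Proof.
case=> /and3P[/eqP cF tF _] pF.
rewrite /excess mulrC ler_pdivrMr //.
under eq_bigr do rewrite outdegE indegE -cF !big_trivIset // !natr_sum -sumrB.
apply: (@le_trans _ _ (\sum_v \sum_(P in F)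
  `|(\sum_(a in P) (a.1 == v))%N%:R - (\sum_(a in P) (a.2 == v))%N%:R|)).
  by apply: ler_sum => v _; apply: ler_norm_sum.
rewrite exchange_big /= mulr_natl -sumr_const; apply: ler_sum => P PF.
exact/path_excess/pF.
Qed.

Lemma consistent_of_le F : path_decomposition D F -> #|F|%:R <= excess D -> consistent D.
Proof.
move=> dF leF; apply/eqP; rewrite eq_le /pn.
case: ex_minnP => k /asboolP[F' dF' <-] kmin; rewrite (excess_le dF') andbT.
apply: le_trans leF; rewrite ler_nat; apply: kmin; apply/asboolP; by exists F.
Qed.

End Excess.

Lemma consistent_of_transitions (V : finType) (D : digraph V) (f : V -> nat) :
  let e := [rel x y | (x, y) \in arcs D] in
  (forall x s, ucycle e (x :: s) ->
    exists2 u, u \in s & ~~ matched e (f u) (prev (x :: s) u) u (next (x :: s) u)) ->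
  consistent D.
Proof.
move=> e broken; apply: (consistent_of_le (starts_decomposition broken)).
rewrite excessE ler_nat; apply: leq_trans (leq_imset_card _ _) _; exact: card_starts.
Qed.

(** * Locally sparse digraphs of odd degree are consistent *)

Section Numerics.
Local Open Scope ring_scope.

Lemma bernoulli (h : rat) n : 0 <= h -> 1 + n%:R * h <= (1 + h) ^+ n.
Proof.
move=> h0; elim: n => [|n IH]; first by rewrite mul0r addr0 expr0.
rewrite exprS -natr1; apply: le_trans (ler_wpM2l _ IH); last by rewrite addr_ge0.
have : 0 <= n%:R * h * h by rewrite !mulr_ge0.
lra.
Qed.

Lemma exists_expr_ge (h M : rat) : 0 < h -> exists n, M <= (1 + h) ^+ n.
Proof.
move=> h0; exists (Num.bound (`|M| / h)).
have : `|M| / h < (Num.bound (`|M| / h))%:R by apply: archi_boundP; rewrite divr_ge0 // ltW.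
rewrite ltr_pdivrMr // => lt; apply: le_trans (bernoulli _ (ltW h0)).
by have := ler_norm M; lra.
Qed.

Lemma exists_expr_le (rho delta : rat) : 0 < rho -> rho < 1 -> 0 < delta ->
  exists n, rho ^+ n <= delta.
Proof.
move=> r0 r1 d0.
have h0 : 0 < rho^-1 - 1 by rewrite subr_gt0 invf_gt1.
have [n] := exists_expr_ge delta^-1 h0; rewrite addrC subrK exprVn => h.
by exists n; rewrite -lef_pV2 ?posrE ?exprn_gt0.
Qed.

Lemma geometric_tail (rho : rat) L N : 0 < rho -> rho < 1 ->
  \sum_(L <= l < N) rho ^+ l <= rho ^+ L / (1 - rho).
Proof.
move=> r0 r1; rewrite ler_pdivlMr ?subr_gt0 //.
case: (leqP L N) => [LN|/ltnW NL]; last first.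
  by rewrite big_geq // mul0r exprn_ge0 // ltW.
suff -> : (\sum_(L <= l < N) rho ^+ l) * (1 - rho) = rho ^+ L - rho ^+ N.
  by rewrite gerBl exprn_ge0 // ltW.
elim: N LN => [|N IH]; first by rewrite leqn0 => /eqP ->; rewrite big_geq // mul0r subrr.
rewrite leq_eqVlt => /orP[/eqP ->|LN]; first by rewrite big_geq // mul0r subrr.
by rewrite big_nat_recr //= mulrDl IH // exprS; ring.
Qed.

(** Bernoulli's inequality gives [l <= (1 + s) ^ l / s], so the tail is dominated by a geometric
    series of ratio [rho]. *)
Lemma exists_tail_le (D s th : rat) : 0 < D -> 0 < s -> 0 < th -> (1 + s) * th < 1 ->
  exists L, forall N, \sum_(L.+1 <= l < N) D * l%:R * th ^+ l <= s.
Proof.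
move=> D0 s0 th0; set rho := (1 + s) * th => rho1.
have rho0 : 0 < rho by rewrite mulr_gt0 //; lra.
have rho1' : 0 < 1 - rho by lra.
(* This bound on [rho ^+ L] is what makes the geometric tail times [D / s] at most [s]. *)
have d0 : 0 < s * (s * (1 - rho) / D) by rewrite !(mulr_gt0, invr_gt0).
have [L hL] := exists_expr_le rho0 rho1 d0; exists L => N.
apply: (@le_trans _ _ (\sum_(L.+1 <= l < N) D / s * rho ^+ l)).
  apply: ler_sum => l _; rewrite exprMn.
  have b : l%:R <= s^-1 * (1 + s) ^+ l.
    by rewrite ler_pdivlMl // mulrC; apply: le_trans (bernoulli l (ltW s0)); rewrite lerDr.
  have := ler_wpM2l (ltW D0) (ler_wpM2r (exprn_ge0 l (ltW th0)) b).
  by rewrite !mulrA.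
have Ds : 0 <= D / s by rewrite divr_ge0 // ltW.
rewrite -mulr_sumr; apply: le_trans (ler_wpM2l Ds (geometric_tail _ _ rho0 rho1)) _.
have step : rho ^+ L.+1 / (1 - rho) <= s * s / D.
  rewrite ler_pdivrMr //; apply: (@le_trans _ _ (rho ^+ L)).
    by rewrite exprS ler_piMl ?exprn_ge0 // ltW.
  by apply: le_trans hL _; rewrite !mulrA mulrAC.
apply: le_trans (ler_wpM2l Ds step) _; rewrite le_eqVlt; apply/orP; left; apply/eqP.
by field; rewrite !gt_eqF.
Qed.

Section Lengths.
Variable d : nat.
Hypothesis d_gt0 : (0 < d)%N.

(** The share of the choices at a vertex conceded to long cycles. It is small enough that three
    factors [ratio] per vertex do not cancel one factor [decay]. *)
Definition slack : rat := (4 * (d%:R + 1))^-1.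
Definition ratio : rat := 1 + slack.
Definition decay : rat := d%:R / (d%:R + 1).

Lemma natr_d_ge1 : 1 <= d%:R :> rat.
Proof. by rewrite ler1n. Qed.

Lemma slack_gt0 : 0 < slack.
Proof. by have dR := natr_d_ge1; rewrite invr_gt0; lra. Qed.

Lemma decay_gt0 : 0 < decay.
Proof. by have dR := natr_d_ge1; rewrite divr_gt0; lra. Qed.

(** The cube is at most [1 + 4 * slack], which is [(d + 2) / (d + 1)], and [d * (d + 2)] is less
    than the square of [d + 1]. *)
Lemma ratio_decay : ratio ^+ 3 * decay < 1.
Proof.
have dR := natr_d_ge1.
have s8 : slack <= 8^-1 by rewrite /slack lef_pV2 ?posrE; lra.
have s0 := slack_gt0.
have r3 : ratio ^+ 3 <= 1 + 4 * slack.
  rewrite /ratio !exprS expr0; nra.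
apply: le_lt_trans (ler_wpM2r (ltW decay_gt0) r3) _.
rewrite /decay /slack.
have -> : (1 + 4 * (4 * (d%:R + 1))^-1) * (d%:R / (d%:R + 1)) =
  (d%:R + 2) * d%:R / (d%:R + 1) ^+ 2 :> rat by field; lra.
have p2 : 0 < (d%:R + 1 : rat) ^+ 2 by rewrite exprn_gt0 //; lra.
by rewrite ltr_pdivrMr // expr2; lra.
Qed.

(** First [L] is taken large enough for the tail, then [K] large enough for one factor [ratio] per
    vertex of a window to pay for its special vertices. *)
Lemma exists_lengths : exists L K : nat, [/\ (0 < K)%N,
  d%:R ^+ (2 * L) <= ratio ^+ K &
  forall N, \sum_(L.+1 <= l < N) d%:R * l%:R * (ratio ^+ 2 * decay) ^+ l <= slack].
Proof.
have d0 : 0 < d%:R :> rat by rewrite ltr0n.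
have s0 := slack_gt0; have r0 : 0 < ratio by rewrite addr_gt0.
have th0 : 0 < ratio ^+ 2 * decay by rewrite mulr_gt0 ?exprn_gt0 // decay_gt0.
have [|L hL] := exists_tail_le d0 s0 th0; first by rewrite mulrA -exprS ratio_decay.
have [K hK] := exists_expr_ge (d%:R ^+ (2 * L)) s0.
exists L, K.+1; split=> //.
by apply: le_trans hK _; rewrite exprS ler_peMl ?exprn_ge0 ?(ltW r0) // lerDl ltW.
Qed.

End Lengths.
End Numerics.

(** * Choosing shifts that break all cycles *)

Section SparseConsistent.
Variables (d L K : nat).
Hypothesis d_odd : odd d.
Hypothesis K_gt0 : 0 < K.
Let r := ratio d.
Hypothesis dL_le : (d%:R ^+ (2 * L) <= r ^+ K)%R.
Hypothesis tail_le : forall N,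
  (\sum_(L.+1 <= l < N) d%:R * l%:R * (r ^+ 2 * decay d) ^+ l <= slack d)%R.

Variables (V : finType) (D : digraph V).
Let e := [rel x y | (x, y) \in arcs D].
Hypothesis D_regular : forall v, outdeg D v + indeg D v = d.
Hypothesis D_sparse : forall X : {set V}, #|X| <= K + L + L -> #|inner e X| <= #|X|.

Let d_gt0 : 0 < d. Proof. by case: d d_odd. Qed.
Let e_irr : irreflexive e := @arcs_irr V D.

Let p v := #|outs e v|.
Let q v := #|ins e v|.
Let m v := maxdeg e v.

Let pqE v : p v + q v = d. Proof. exact: D_regular. Qed.

Let m_le v : m v <= d.
Proof. by rewrite /m /maxdeg -/(p v) -/(q v); have := pqE v; lia. Qed.

Let m_gt0 v : 0 < m v.
Proof. by rewrite /m /maxdeg -/(p v) -/(q v); have := pqE v; lia. Qed.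

Definition unbroken (s : nat) v : Prop :=
  exists c, [/\ ucycle e c, size c <= L, v \in c & matched e s (prev c v) v (next c v)].

(* At a vertex of a short cycle only the shifts that break the cycle are allowed;
   elsewhere [shifts v] has all [m v] shifts. *)
Definition shifts v : {set 'I_d.+1} := [set s : 'I_d.+1 | (s < m v) && ~~ `[< unbroken s v >]].

Lemma card_ord_lt n k : k <= n -> #|[set s : 'I_n | s < k]| = k.
Proof.
move=> kn; rewrite -sum1dep_card -(big_ord_widen n (fun=> 1) kn).
by rewrite sum1_card card_ord.
Qed.

Lemma card_shifts v : ~~ special e L v -> #|shifts v| = m v.
Proof.
move=> nsp; rewrite -[RHS](card_ord_lt (leq_trans (m_le v) (leqnSn d))).
apply: eq_card => s; rewrite !inE andbC; case: asboolP => // -[c [uc sc vc _]].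
by case/negP: nsp; apply/asboolP; exists c.
Qed.

Lemma cycle_pos c v : cycle e c -> v \in c -> 0 < p v /\ 0 < q v.
Proof.
move=> cc vc; split; apply/card_gt0P.
  by exists (next c v); rewrite inE; exact: next_cycle.
by exists (prev c v); rewrite inE; exact: prev_cycle.
Qed.

Lemma shifts_gt0 v : 0 < #|shifts v|.
Proof.
case: (boolP (special e L v)) => [|/card_shifts -> //].
case/asboolP => c [uc sc vc]; have [p0 q0] := cycle_pos (proj1 (andP uc)) vc.
(* Both degrees are positive with odd sum, so they are not both 1. Two shifts are thus available at
   [v], and at most one of them is unbroken. *)
have m2 : 1 < m v.
  rewrite /m /maxdeg -/(p v) -/(q v); have := pqE v; move: d_odd p0 q0.
  case: (p v) (q v) => [|[|k]] [|[|k']] //= + _ _ E; rewrite -E ?addnS //=; lia.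
have unbE s : unbroken s v -> matched e s (prev c v) v (next c v).
  case=> c' [uc' sc' vc' M].
  have sz : size c + size c' <= K + L + L.
    by rewrite -addnA -[size c]add0n -addnA leq_add // leq_add.
  by have [-> ->] := overlap_next D_sparse uc uc' sz vc vc'.
have d2 : 1 < d.+1 by rewrite ltnS.
case: (pselect (unbroken 0 v)) => u0; last first.
  apply/card_gt0P; exists ord0; rewrite inE m_gt0; exact/asboolPn.
apply/card_gt0P; exists (Ordinal d2); rewrite inE /= m2; apply/asboolPn => u1.
by have := matched_shift_inj (m_gt0 v) m2 (unbE _ u0) (unbE _ u1).
Qed.

Local Open Scope ring_scope.

(** Chosen so that [c v * (1 + slack d)] is exactly [#|shifts v|]. *)
Let c v : rat := #|shifts v|%:R / r.

Let s0 : 0 < slack d := slack_gt0 d_gt0.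
Let r_gt0 : 0 < r. Proof. by rewrite addr_gt0 ?s0. Qed.
Let r_ge1 : 1 <= r. Proof. by rewrite lerDl ltW ?s0. Qed.

Lemma inv_c_le v : (c v)^-1 <= r * (if special e L v then d%:R else 1) * (m v)%:R^-1.
Proof.
rewrite /c invf_div -mulrA ler_pM2l ?r_gt0 //; case: ifP => [_|/negbT/card_shifts -> //].
  apply: (@le_trans _ _ 1).
    by rewrite invf_le1 ?ler1n ?ltr0n shifts_gt0.
  by rewrite ler_pdivlMr ?ltr0n ?m_gt0 // mul1r ler_nat m_le.
by rewrite mul1r.
Qed.

(** The leading [d%:R] pays for the weight of the exempt vertex [x]. One factor [r] per vertex comes
    from [c], the other covers the special vertices, where possibly a single shift is left. *)
Lemma prod_inv_c x s : ucycle e (x :: s) -> (L < size (x :: s))%N ->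
  \prod_(u <- s) (c u)^-1 <=
  d%:R * r ^+ (2 * size (x :: s)) * \prod_(u <- x :: s) (m u)%:R^-1.
Proof.
move=> uc Ls.
have cnt := count_special_cycle e_irr D_sparse K_gt0 (leqnn _) uc Ls.
have d1 : 1 <= d%:R :> rat by rewrite ler1n.
have step1 : \prod_(u <- s) (c u)^-1 <=
    r ^+ size s * d%:R ^+ count (special e L) s * \prod_(u <- s) (m u)%:R^-1.
  elim: (s) => [|u t IH]; first by rewrite !big_nil !mulr1.
  rewrite !big_cons /=.
  have -> : r ^+ (size t).+1 * d%:R ^+ (special e L u + count (special e L) t) *
     ((m u)%:R^-1 * \prod_(j <- t) (m j)%:R^-1) =
     (r * (if special e L u then d%:R else 1) * (m u)%:R^-1) *
     (r ^+ size t * d%:R ^+ count (special e L) t * \prod_(j <- t) (m j)%:R^-1).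
    by rewrite exprS exprD; case: (special e L u); rewrite ?expr0 ?expr1; ring.
  apply: ler_pM => //; last exact: inv_c_le.
    by rewrite invr_ge0 divr_ge0 // ltW ?r_gt0.
  by apply: prodr_ge0 => j _; rewrite invr_ge0 divr_ge0 // ltW ?r_gt0.
have step2 : d%:R ^+ count (special e L) s <= r ^+ size s.
  apply: (@le_trans _ _ (d%:R ^+ ((2 * L) * (size s %/ K)))).
    by rewrite ler_weXn2l.
  rewrite exprM; apply: (@le_trans _ _ ((r ^+ K) ^+ (size s %/ K))).
    by rewrite lerXn2r // nnegrE exprn_ge0 ?(ltW r_gt0).
  by rewrite -exprM ler_weXn2l // mulnC leq_trunc_div.
apply: le_trans step1 _; rewrite big_cons mulrA.
have P0 : 0 <= \prod_(u <- s) (m u)%:R^-1 :> rat by apply: prodr_ge0 => u _; rewrite invr_ge0.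
apply: ler_wpM2r => //.
apply: (@le_trans _ _ (r ^+ size s * r ^+ size s)).
  by rewrite ler_wpM2l ?exprn_ge0 ?(ltW r_gt0).
rewrite -exprD addnn -mul2n mulrAC.
apply: (@le_trans _ _ (1 * r ^+ (2 * size (x :: s)))).
  by rewrite mul1r ler_weXn2l //= mulnS leqW // leqW.
apply: ler_wpM2r; first by rewrite exprn_ge0 ?(ltW r_gt0).
by rewrite ler_pdivlMr ?ltr0n ?m_gt0 // mul1r ler_nat m_le.
Qed.

(* The factor [decay d ^+ 2] comes from [p v != q v]: the smaller of the two is at
   most [(d - 1) / 2]. *)
Lemma inv_m_sqr v : (0 < p v)%N -> (0 < q v)%N ->
  ((m v)%:R^-1) ^+ 2 <= decay d ^+ 2 * ((p v)%:R^-1 * (q v)%:R^-1) :> rat.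
Proof.
move=> p0 q0; rewrite /decay.
have E : (p v * q v * d.+1 ^ 2 <= d ^ 2 * m v ^ 2)%N.
  rewrite /m /maxdeg -/(p v) -/(q v); have := pqE v; move: d_odd p0 q0.
  move: (p v) (q v) => P Q dodd P0 Q0 PQ.
  have PQn : P != Q by apply: contraTneq dodd => PQe; rewrite -PQ PQe addnn odd_double.
  case: (ltngtP P Q) PQn => // PQlt _; nia.
have : (p v)%:R * (q v)%:R * (d%:R + 1) ^+ 2 <= d%:R ^+ 2 * (m v)%:R ^+ 2 :> rat.
  by rewrite natr1 -!natrX -!natrM ler_nat.
have pR : 0 < (p v)%:R :> rat by rewrite ltr0n.
have qR : 0 < (q v)%:R :> rat by rewrite ltr0n.
have mR : 0 < (m v)%:R :> rat by rewrite ltr0n m_gt0.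
have dR : 0 < d%:R + 1 :> rat by rewrite ltr_wpDl.
move: (p v)%:R (q v)%:R (m v)%:R (d%:R : rat) pR qR mR dR => P Q M d' pR qR mR dR h.
have -> : (d' / (d' + 1)) ^+ 2 * (P^-1 * Q^-1) = d' ^+ 2 / (P * Q * (d' + 1) ^+ 2).
  by field; rewrite !gt_eqF.
rewrite ler_pdivlMr ?mulr_gt0 ?exprn_gt0 // exprVn mulrC ler_pdivrMr ?exprn_gt0 //.
Qed.

(** Multiplying [inv_m_sqr] along the cycle bounds the square by the product of the two walk
    weights; AM-GM turns the geometric mean into the average. *)
Lemma prod_inv_m cc : cycle e cc ->
  \prod_(u <- cc) (m u)%:R^-1 <= decay d ^+ size cc *
   (2^-1 * (\prod_(u <- cc) (p u)%:R^-1 + \prod_(u <- cc) (q u)%:R^-1)) :> rat.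
Proof.
move=> ccP; set X := \prod_(u <- cc) _; set A := \prod_(u <- cc) _; set B := \prod_(u <- cc) _.
have A0 : 0 <= A by apply: prodr_ge0 => u _; rewrite invr_ge0.
have B0 : 0 <= B by apply: prodr_ge0 => u _; rewrite invr_ge0.
have X0 : 0 <= X by apply: prodr_ge0 => u _; rewrite invr_ge0.
have g0 : 0 <= decay d ^+ size cc by rewrite exprn_ge0 // ltW ?decay_gt0.
have X2 : X ^+ 2 <= (decay d ^+ size cc) ^+ 2 * (A * B).
  have : all (fun u => (0 < p u)%N && (0 < q u)%N) cc.
    by apply/allP => u uc; apply/andP; apply: cycle_pos ccP uc.
  rewrite /X /A /B -exprM mulnC exprM.
  elim: (cc) => [|u t IH] /=; first by rewrite !big_nil expr1n !mulr1.
  move=> /andP[/andP[p0 q0] /IH {}IH]; rewrite !big_cons [_ ^+ (size t).+1]exprS exprMn.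
  have -> (a b P Q P' Q' : rat) : a * b * (P * P' * (Q * Q')) = (a * (P * Q)) * (b * (P' * Q')).
    by ring.
  by apply: ler_pM (inv_m_sqr p0 q0) IH; 
    rewrite exprn_ge0 ?invr_ge0 ?prodr_ge0 // => v _; rewrite invr_ge0.
rewrite -(@ler_pXn2r _ 2) ?nnegrE ?mulr_ge0 ?addr_ge0 //.
apply: le_trans X2 _; rewrite [leRHS]exprMn; apply: ler_wpM2l; first by rewrite exprn_ge0.
by rewrite -subr_ge0; have := sqr_ge0 (A - B); rewrite !expr2; lra.
Qed.


(** Every rotation of a cycle is a separate entry, its head being the vertex exempt from
    breaking. *)
Definition long_cycles : seq (seq V) :=
  flatten [seq map (@tval l V)
                [seq t : l.-tuple V <- enum {: l.-tuple V} | cycle e t && uniq t] |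
           l <- index_iota L.+1 #|V|.+1].

(** The only shift below [m u] that follows the cycle at [u]. The default [ord0], used when there is
    none, can only enlarge the event to be avoided. *)
Definition kept_shift (cc : seq V) (u : V) : 'I_d.+1 :=
  odflt ord0 [pick s : 'I_d.+1 | (s < m u)%N && matched e s (prev cc u) u (next cc u)].

Lemma mem_long_cycles cc : (cc \in long_cycles) = [&& (L < size cc)%N, cycle e cc & uniq cc].
Proof.
apply/flattenP/and3P => [[_ /mapP[l + ->] /mapP[t]]|[Ls cyc uni]].
  rewrite mem_index_iota => /andP[Ll _]; rewrite mem_filter => /andP[/andP[cyc uni] _] ->.
  by rewrite size_tuple; split.
exists (map (@tval (size cc) V)
  [seq t : (size cc).-tuple V <- enum {: (size cc).-tuple V} | cycle e t && uniq t]).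
  apply/mapP; exists (size cc) => //; rewrite mem_index_iota Ls ltnS.
  by rewrite -(card_uniqP uni) max_card.
apply/mapP; exists (in_tuple cc) => //.
by rewrite mem_filter /= cyc uni mem_enum.
Qed.

Lemma sum_long_cycles v :
  \sum_(cc <- long_cycles | v \in [set u in behead cc])
    \prod_(u in [set u in behead cc]) (c u)^-1 <= slack d.
Proof.
apply: le_trans (tail_le #|V|.+1).
rewrite /long_cycles big_flatten /= big_map; rewrite !big_seq; apply: ler_sum => l.
rewrite mem_index_iota => /andP[Ll _]; rewrite big_map big_filter_cond big_enum_cond /=.
pose w (t : seq V) : rat := d%:R * (r ^+ 2 * decay d) ^+ l *
  (2^-1 * (\prod_(u <- t) (p u)%:R^-1 + \prod_(u <- t) (q u)%:R^-1)).
have th0 : 0 <= d%:R * (r ^+ 2 * decay d) ^+ l.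
  by rewrite mulr_ge0 // exprn_ge0 // mulr_ge0 ?exprn_ge0 ?(ltW r_gt0) // ltW ?decay_gt0.
have w0 t : 0 <= w t.
  by rewrite mulr_ge0 // mulr_ge0 // addr_ge0 // prodr_ge0 // => u _; rewrite invr_ge0.
(* Distinctness of the vertices is dropped: cycles become closed walks, whose forward and backward
   masses are each at most [l]. *)
apply: (@le_trans _ _ (\sum_(t : l.-tuple V | cycle e t && (v \in tval t)) w t)).
  rewrite big_mkcond [leRHS]big_mkcond; apply: ler_sum => t _.
  case: ifP => [/andP[/andP[cyc uni]]|_]; last by case: ifP.
  rewrite cyc inE; case: (tval t) (size_tuple t) cyc uni => [|x s] //= szt cyc uni vs.
  rewrite inE vs orbT.
  rewrite (eq_bigl (fun u => u \in s)) => [|u]; last by rewrite inE.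
  have /andP[xs us] : (x \notin s) && uniq s by [].
  rewrite -(big_uniq _ us).
  have uc : ucycle e (x :: s) by apply/andP; split.
  have Ls : (L < size (x :: s))%N by rewrite /= szt.
  apply: le_trans (prod_inv_c uc Ls) _.
  rewrite /w exprMn -exprM [size _]szt -!mulrA.
  rewrite ler_pM2l ?ltr0n ?d_gt0 // ler_pM2l ?exprn_gt0 ?r_gt0 //.
  by have := @prod_inv_m (x :: s) cyc; rewrite [size _]szt.
rewrite [leRHS]mulrAC -mulr_sumr; apply: ler_wpM2l => //; rewrite -mulr_sumr big_split /=.
have := sum_closed_walks e l v; have := sum_closed_walks_rev e l v.
rewrite -/(p _) -/(q _); rewrite /p /q /outs /ins; lra.
Qed.

Theorem consistent_of_sparse : consistent D.
Proof.
have [|||f [fW fev]] := @exists_avoiding V 'I_d.+1 ord0 shifts (seq V) long_cycles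
  (fun cc => [set u in behead cc]) kept_shift c.
- move=> cc; rewrite mem_long_cycles => /and3P[Ls cyc uni]; apply/set0Pn.
  case: cc Ls cyc uni => [|x [|y s]] //=.
    by rewrite (e_irr x : ((x, x) \in arcs D) = false).
  by move=> _ _ _; exists y; rewrite inE mem_head.
- by move=> v; rewrite divr_gt0 ?r_gt0 // ltr0n shifts_gt0.
- move=> v.
  have cv0 : 0 < c v by rewrite divr_gt0 ?r_gt0 // ltr0n shifts_gt0.
  (* Restoring the missing factor at [v] turns the sum into [c v] times the one in
     [sum_long_cycles]. *)
  rewrite (eq_bigr (fun cc => c v * \prod_(u in [set u in behead cc]) (c u)^-1)); last first.
    by move=> cc vc; rewrite (big_setD1 v vc) /= mulrA divff ?mul1r // gt_eqF.
  rewrite -mulr_sumr.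
  apply: (@le_trans _ _ (c v + c v * slack d)).
    by rewrite lerD2l ler_pM2l // sum_long_cycles.
  rewrite -{1}[c v]mulr1 -mulrDr /c mulfVK // gt_eqF // r_gt0.
apply: (@consistent_of_transitions _ _ (fun v => f v)) => x s uc.
have /andP[cyc uni] := uc.
have bounded u : (f u < m u)%N by have := fW u; rewrite inE => /andP[].
(* The shifts break a short cycle at each of its vertices; the second one exists for lack of
   loops. *)
case: (leqP (size (x :: s)) L) => [sL|Ls].
  case: s uc cyc uni sL => [|y s] uc cyc uni sL; 
    first by rewrite /= (e_irr x : ((x, x) \in arcs D) = false) in cyc.
  exists y; first exact: mem_head.
  have := fW y; rewrite inE => /andP[_]; apply: contra => M; apply/asboolP.
  by exists (x :: y :: s); split=> //; rewrite inE mem_head orbT.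
(* A long cycle is an avoided event, so some shift differs from [kept_shift] and hence does not
   follow the cycle. *)
have : x :: s \in long_cycles by rewrite mem_long_cycles Ls cyc uni.
move/fev/forall_inPn => [u]; rewrite inE /= => us neq; exists u => //.
apply: contra neq => M; rewrite /kept_shift; case: pickP => [t /andP[tm Mt]|].
  by apply/eqP/val_inj; exact: matched_shift_inj M Mt.
by move/(_ (f u)); rewrite bounded M.
Qed.

End SparseConsistent.

Theorem sparse_consistent d : odd d -> exists K0, forall (V : finType) (D : digraph V),
  (forall v, outdeg D v + indeg D v = d) ->
  (forall X : {set V}, #|X| <= K0 ->
    #|inner [rel x y | (x, y) \in arcs D] X| <= #|X|) ->
  consistent D.
Proof.
move=> dodd; have d_gt0 : 0 < d by case: d dodd.
have [L [K [K0 dL tl]]] := exists_lengths d_gt0.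
by exists (K + L + L) => V D reg sp; apply: (consistent_of_sparse dodd K0 dL tl).
Qed.

(** * Switchings in random regular graphs *)

Section GraphLemmas.
Variable V : finType.
Implicit Types (G : sgraph V) (D : digraph V) (X : {set V}).

Lemma eq_set2 (x y x' y' : V) : [set x; y] = [set x'; y'] ->
  (x = x' /\ y = y') \/ (x = y' /\ y = x').
Proof.
move=> E; have /set2P xP : x \in [set x'; y'] by rewrite -E set21.
have /set2P yP : y \in [set x'; y'] by rewrite -E set22.
have /set2P x'P : x' \in [set x; y] by rewrite E set21.
have /set2P y'P : y' \in [set x; y] by rewrite E set22.
clear E; intuition congruence.
Qed.

Lemma card_edge G z : z \in edges G -> #|z| = 2.
Proof. by case: G => E /= /forall_inP P /P/eqP. Qed.

Lemma edge_neq G x y : [set x; y] \in edges G -> x != y.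
Proof. by move/card_edge; rewrite cards2; case: eqP. Qed.

Definition neighbours G u := [set x | [set u; x] \in edges G].

Lemma set2_injr (u : V) : injective (fun x => [set u; x]).
Proof. by move=> x y /eq_set2[[]|[-> ->]]. Qed.

Lemma card_neighbours G u : #|neighbours G u| = degree G u.
Proof.
rewrite /degree -(card_imset _ (@set2_injr u)); apply: eq_card => z.
rewrite !inE; apply/imsetP/andP => [[x + ->]|[zE uz]].
  by rewrite inE => ->; rewrite !inE eqxx.
have /eqP := card_edge zE; rewrite (cardsD1 u) uz add1n eqSS => /cards1P[x zx].
exists x; last by rewrite -zx setD1K.
by rewrite inE -zx setD1K.
Qed.

Definition inner_edges G X := [set z in edges G | z \subset X].

Definition sparse k G : bool :=
  [forall X : {set V}, (#|X| <= k) ==> (#|inner_edges G X| <= #|X|)].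

Lemma arcs_inj D : oriented D -> {in arcs D &, injective (fun a => [set a.1; a.2])}.
Proof.
move=> oD [x y] [x' y'] xy x'y' /= /eq_set2[[-> ->]//|[xE yE]].
by move: (oD _ _ xy); rewrite xE yE x'y'.
Qed.

Lemma orientation_degree G D v : orientation G D -> outdeg D v + indeg D v = degree G v.
Proof.
case=> oD GE.
have -> : degree G v = #|[set a in arcs D | (a.1 == v) || (a.2 == v)]|.
  rewrite -(@card_in_imset _ _ (fun a => [set a.1; a.2])); last first.
    by apply: sub_in2 (arcs_inj oD) => a; rewrite inE => /andP[].
  apply: eq_card => z; rewrite inE -GE; apply/andP/imsetP => [[/imsetP[a aD ->]]|[a]].
    by rewrite !inE ![v == _]eq_sym => va; exists a; rewrite ?inE ?aD.
  rewrite inE => /andP[aD va] ->; split; first exact: imset_f.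
  by rewrite !inE ![v == _]eq_sym.
rewrite outdegE indegE -big_split /= -sum1dep_card big_mkcondr /=; apply: eq_bigr => -[x y] xy.
have nxy : x != y.
  by apply: contraTneq xy => ->; rewrite (@arcs_irr V D y : ((y, y) \in arcs D) = false).
rewrite /=; case: (eqVneq x v) => [<-|_]; last by case: eqP.
by rewrite eq_sym (negPf nxy).
Qed.

Lemma orientation_sparse G D k X : orientation G D -> sparse k G -> #|X| <= k ->
  #|inner [rel x y | (x, y) \in arcs D] X| <= #|X|.
Proof.
case=> oD GE /forallP/(_ X)/implyP spG /spG; apply: leq_trans.
rewrite -(@card_in_imset _ _ (fun a => [set a.1; a.2])); last first.
  by apply: sub_in2 (arcs_inj oD) => -[x y]; rewrite inE => /andP[].
apply/subset_leq_card/subsetP => _ /imsetP[[x y] + ->].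
rewrite !inE /= => /and3P[xy xX yX]; rewrite subUset !sub1set xX yX !andbT.
by rewrite -GE; apply/imsetP; exists (x, y).
Qed.

End GraphLemmas.

Lemma sparse_strongly_consistent d : odd d -> exists k, forall (V : finType) (G : sgraph V),
  regular d G -> sparse k G -> strongly_consistent G.
Proof.
move=> dodd; have [k kP] := sparse_consistent dodd; exists k => V G /forallP reg sp D oD.
apply: kP => [v|X]; first by rewrite (orientation_degree v oD); apply/eqP.
exact: orientation_sparse oD sp.
Qed.

(** * Switching edges in regular graphs *)

Section Switching.
Variables (V : finType) (d : nat).
Implicit Types (G : sgraph V) (H : {set {set V}}).

Definition containing H := [set G : sgraph V | regular d G && (H \subset edges G)].

Definition switched G (u v x y : V) : {set {set V}} :=
  [set u; x] |: ([set v; y] |: (edges G :\ [set u; v] :\ [set x; y])).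

(* The default value of [insubd] is not used for [switchable] quadruples. *)
Definition switch G (u v x y : V) : sgraph V := insubd G (switched G u v x y).

(** Keeping [x] off [cover H] protects the edges of [H] other than [uv] and, when [uv] is in [H],
    separates [x] from [u] and [v]. The other exclusions keep [y] off [u] and [v] and the two new
    edges out of [G]. *)
Definition switchable G H (u v x y : V) : bool :=
  [&& y \in neighbours G x, x \notin cover H :|: neighbours G u &
      y \notin [set u; v] :|: neighbours G v].

Lemma card_pairs_on (S : {set V}) (N : V -> {set V}) :
  #|[set xy : V * V | (xy.1 \in S) && (xy.2 \in N xy.1)]| = \sum_(x in S) #|N x|.
Proof.
under eq_bigr do rewrite -sum1_card.
by rewrite pair_big_dep /= -sum1dep_card.
Qed.

Lemma regular_card_neighbours G u : regular d G -> #|neighbours G u| = d.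
Proof. by move=> /forallP/(_ u)/eqP; rewrite card_neighbours. Qed.

Lemma neighbours_sym G x y : (x \in neighbours G y) = (y \in neighbours G x).
Proof. by rewrite !inE setUC. Qed.

(** There are [#|V| * d] ordered adjacent pairs, and each forbidden value of [x] or of [y] spoils
    [d] of them. *)
Lemma card_switchable G H u v : regular d G -> H \subset edges G ->
  #|V| * d <= #|[set xy : V * V | switchable G H u v xy.1 xy.2]|
     + d * (2 * #|H| + d) + d * (2 + d).
Proof.
move=> rG HG; set S := cover H :|: neighbours G u; set S2 := [set u; v] :|: neighbours G v.
have cS : #|S| <= 2 * #|H| + d.
  apply: leq_trans (leq_card_setU _ _) _; rewrite regular_card_neighbours // leq_add2r.
  apply: leq_trans (leq_card_cover H) _; rewrite mulnC -sum_nat_const.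
  by apply: leq_sum => z zH; rewrite (card_edge (subsetP HG z zH)).
have cS2 : #|S2| <= 2 + d.
  apply: leq_trans (leq_card_setU _ _) _; rewrite regular_card_neighbours // leq_add2r.
  by rewrite cards2; case: (_ == _).
pose P1 := [set xy : V * V | (xy.1 \in S) && (xy.2 \in neighbours G xy.1)].
pose P2 := [set xy : V * V | (xy.2 \in S2) && (xy.1 \in neighbours G xy.2)].
have c1 : #|P1| <= d * (2 * #|H| + d).
  rewrite card_pairs_on (eq_bigr (fun=> d)) => [|x _]; last exact: regular_card_neighbours.
  by rewrite sum_nat_const mulnC leq_mul2l cS orbT.
have c2 : #|P2| <= d * (2 + d).
  pose sw (xy : V * V) := (xy.2, xy.1).
  have swI : injective sw by move=> [x y] [x' y'] [-> ->].
  rewrite -(card_imset _ swI).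
  apply: (@leq_trans #|[set xy : V * V | (xy.1 \in S2) && (xy.2 \in neighbours G xy.1)]|).
    by apply/subset_leq_card/subsetP => _ /imsetP[[x y] + ->]; rewrite !inE.
  rewrite card_pairs_on (eq_bigr (fun=> d)) => [|x _]; last exact: regular_card_neighbours.
  by rewrite sum_nat_const mulnC leq_mul2l cS2 orbT.
apply: leq_trans (leq_add (leq_add (leqnn _) c1) c2).
have -> : #|V| * d = #|[set xy : V * V | (xy.1 \in [set: V]) && (xy.2 \in neighbours G xy.1)]|.
  rewrite card_pairs_on (eq_bigr (fun=> d)) => [|x _]; last exact: regular_card_neighbours.
  by rewrite sum_nat_const cardsT.
apply: (@leq_trans #|[set xy : V * V | switchable G H u v xy.1 xy.2] :|: P1 :|: P2|); last first.
  apply: leq_trans (leq_card_setU _ _) _; rewrite leq_add2r; exact: leq_card_setU.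
apply/subset_leq_card/subsetP => -[x y] xyN.
have {xyN} yN : y \in neighbours G x by move: xyN; rewrite in_set => /andP[].
case: (boolP (x \in S)) => xS.
  by apply/setUP; left; apply/setUP; right; rewrite in_set /= xS.
case: (boolP (y \in S2)) => yS.
  by apply/setUP; right; rewrite in_set /= yS neighbours_sym.
by apply/setUP; left; apply/setUP; left; rewrite in_set /= /switchable yN -/S xS.
Qed.

Section Edge.
Variables (H : {set {set V}}) (u v : V).
Hypothesis uvH : [set u; v] \in H.

Lemma switchableP G x y : H \subset edges G -> switchable G H u v x y ->
  [/\ [&& x != u, x != v, y != u, y != v & x != y], [set x; y] \in edges G,
      [set x; y] \notin H, [set u; x] \notin edges G & [set v; y] \notin edges G].
Proof.
move=> HG /and3P[xy xS yS].
move: xS yS; rewrite !in_setU !negb_or => /andP[xH ux] /andP[/andP[yu yv] vy].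
rewrite !in_set1 in yu yv; rewrite !in_set in ux vy xy.
have inH z : z \in [set u; v] -> z \in cover H.
  by move=> zuv; apply/bigcupP; exists [set u; v].
have xu : x != u by apply: contraNneq xH => ->; rewrite inH ?set21.
have xv : x != v by apply: contraNneq xH => ->; rewrite inH ?set22.
split=> //; first by rewrite xu xv yu yv (edge_neq xy).
by apply: contra xH => xyH; apply/bigcupP; exists [set x; y]; rewrite ?set21.
Qed.

Lemma switchE G x y : H \subset edges G -> switchable G H u v x y ->
  edges (switch G u v x y) = switched G u v x y.
Proof.
move=> HG sw; have [/and5P[xu xv yu yv xy] _ _ _ _] := switchableP HG sw.
rewrite -[LHS]/(\val (switch G u v x y)) /switch insubdK //; apply/forall_inP => z.
rewrite !inE => /or3P[/eqP ->|/eqP ->|/and3P[_ _ /card_edge -> //]].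
  by rewrite cards2 [u == x]eq_sym xu.
by rewrite cards2 [v == y]eq_sym yv.
Qed.

Lemma degreeE G w : degree G w = \sum_(z in edges G) (w \in z).
Proof. by rewrite /degree -sum1dep_card big_mkcondr. Qed.

(** The removed edges and the added edges both cover each of [u], [v], [x], [y] exactly once. *)
Lemma switch_containing G x y : G \in containing H -> switchable G H u v x y ->
  switch G u v x y \in containing (H :\ [set u; v]).
Proof.
rewrite !inE => /andP[rG HG] sw.
have [/and5P[xu xv yu yv xy] xyE xyH uxE vyE] := switchableP HG sw.
have uvE := subsetP HG _ uvH; have uv := edge_neq uvE.
apply/andP; split; last first.
  rewrite switchE //; apply/subsetP => z; rewrite !inE => /andP[zuv zH].
  by rewrite zuv (subsetP HG z zH) (contraNneq _ xyH) ?orbT // => <-.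
apply/forallP => w; have /forallP/(_ w)/eqP <- := rG.
apply/eqP; rewrite !degreeE switchE // /switched.
have nxy : [set x; y] != [set u; v] by apply: contraNneq xyH => ->.
rewrite [RHS](big_setD1 [set u; v]) //= [X in _ = _ + X](big_setD1 [set x; y]) /=; last first.
  by rewrite in_setD1 nxy.
rewrite big_setU1 /=; last first.
  rewrite !inE !negb_or (negPf uxE) !andbF andbT; apply/eqP => /eq_set2[[E _]|[E _]].
    by rewrite E eqxx in uv.
  by rewrite E eqxx in yu.
rewrite big_setU1 /=; last by rewrite !inE (negPf vyE) !andbF.
rewrite !addnA; congr (_ + _); rewrite !inE.
case: (eqVneq w u) => [->|wu]; 
  first by rewrite (negPf uv) (eq_sym u x) (negPf xu) (eq_sym u y) (negPf yu).
case: (eqVneq w v) => [->|wv]; 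
  first by rewrite (eq_sym v x) (negPf xv) (eq_sym v y) (negPf yv).
by case: (eqVneq w x) => [->|wx] /=; [rewrite (negPf xy) | case: eqP].
Qed.

(** Switchability fixes the status of the four altered pairs in the original graph; every other edge
    can be read off the result. *)
Lemma switch_inj G1 G2 x y : H \subset edges G1 -> H \subset edges G2 ->
  switchable G1 H u v x y -> switchable G2 H u v x y ->
  switch G1 u v x y = switch G2 u v x y -> G1 = G2.
Proof.
move=> HG1 HG2 sw1 sw2 /(congr1 (@edges V)); rewrite !switchE // => /setP E.
have [_ xyE1 _ uxE1 vyE1] := switchableP HG1 sw1.
have [_ xyE2 _ uxE2 vyE2] := switchableP HG2 sw2.
apply: val_inj; apply/setP => z /=; have := E z; rewrite !inE.
case: (eqVneq z [set u; v]) => [->|_]; first by rewrite !(subsetP HG1, subsetP HG2).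
case: (eqVneq z [set x; y]) => [->|_]; first by rewrite xyE1 xyE2.
case: (eqVneq z [set u; x]) => [->|_]; first by rewrite (negPf uxE1) (negPf uxE2).
by case: (eqVneq z [set v; y]) => [->|_]; first by rewrite (negPf vyE1) (negPf vyE2).
Qed.

(* Each graph containing [H] admits at least [#|V| / 2] switchings away from
   [uv], and each graph arises from at most [d ^ 2] of them. *)
Lemma card_containing_edge : 0 < d -> 2 * (2 * #|H| + 2 * d + 2) <= #|V| ->
  #|containing H| * #|V| <= 2 * d ^ 2 * #|containing (H :\ [set u; v])|.
Proof.
move=> d0 nlarge.
pose T := [set t : sgraph V * (V * V) |
  (t.1 \in containing H) && switchable t.1 H u v t.2.1 t.2.2].
pose T' := [set t : sgraph V * (V * V) |
  [&& t.1 \in containing (H :\ [set u; v]), t.2.1 \in neighbours t.1 u &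
      t.2.2 \in neighbours t.1 v]].
have cT : #|containing H| * #|V| <= 2 * #|T|.
  have -> : #|T| = \sum_(G in containing H) #|[set xy : V * V | switchable G H u v xy.1 xy.2]|.
    under eq_bigr do rewrite -sum1dep_card.
    by rewrite pair_big_dep /= -sum1dep_card.
  rewrite big_distrr /= -sum_nat_const; apply: leq_sum => G; rewrite inE => /andP[rG HG].
  have := card_switchable u v rG HG.
  move: #|[set xy : V * V | _]| #|H| #|V| nlarge d0 => a h n; nia.
have cT' : #|T'| <= d ^ 2 * #|containing (H :\ [set u; v])|.
  have -> : #|T'| = \sum_(G in containing (H :\ [set u; v]))
      #|setX (neighbours G u) (neighbours G v)|.
    under eq_bigr do rewrite -sum1_card.
    rewrite pair_big_dep /= -sum1dep_card; apply: eq_bigl => -[G [x y]] /=.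
    by rewrite in_setX.
  rewrite mulnC -sum_nat_const; apply: leq_sum => G; rewrite inE => /andP[rG _].
  by rewrite cardsX !regular_card_neighbours // mulnn.
apply: leq_trans cT _; rewrite -mulnA leq_mul2l /=; apply: leq_trans cT'.
(* Keeping the pair beside the new graph makes switching injective; the pair lies among the
   neighbours of [u] and of [v] there. *)
pose h (t : sgraph V * (V * V)) := (switch t.1 u v t.2.1 t.2.2, t.2).
have <- : #|h @: T| = #|T|.
  apply: card_in_imset => -[G1 [x y]] [G2 [x' y']]; rewrite !inE /=.
  move=> /andP[/andP[_ HG1] sw1] /andP[/andP[_ HG2] sw2].
  move=> [E Ex Ey]; rewrite -Ex -Ey in sw2 E *.
  by rewrite (switch_inj HG1 HG2 sw1 sw2 E).
apply/subset_leq_card/subsetP => _ /imsetP[[G [x y]] + ->].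
rewrite in_set /= => /andP[GH sw].
have HG : H \subset edges G by move: GH; rewrite inE => /andP[].
rewrite in_set /= (switch_containing GH sw) !in_set switchE // /switched.
by rewrite !in_setU !in_set1 !eqxx ?orbT.
Qed.

End Edge.

(** The edges of [H] are removed one at a time, each at a cost of [2 * d ^ 2 / #|V|]. The uniform
    bound [h] keeps the size condition valid throughout. *)
Lemma card_containing h H : 0 < d -> #|H| <= h -> 2 * (2 * h + 2 * d + 2) <= #|V| ->
  #|containing H| * #|V| ^ #|H| <= (2 * d ^ 2) ^ #|H| * #|containing set0|.
Proof.
move=> d0 Hh nlarge; have [k] := ubnP #|H|; elim: k H Hh => // k IH H Hh; rewrite ltnS => Hk.
have [->|[z zH]] := set_0Vmem H; first by rewrite cards0 !expn0 muln1 mul1n.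
have cH : #|H| = #|H :\ z|.+1 by rewrite (cardsD1 z) zH.
rewrite cH in Hk *.
have [GE|[G]] := set_0Vmem (containing H); first by rewrite GE cards0.
rewrite inE => /andP[_ HG].
have /eqP/cards2P[u [v [uv zE]]] := card_edge (subsetP HG z zH).
have HzH : #|H :\ z| <= h by apply: leq_trans (subset_leq_card (subsetDl _ _)) Hh.
rewrite [#|V| ^ _]expnS [(2 * d ^ 2) ^ _]expnS; have := IH _ HzH Hk; subst z.
have := card_containing_edge zH d0 (leq_trans _ nlarge).
have -> : 2 * (2 * #|H| + 2 * d + 2) <= 2 * (2 * h + 2 * d + 2) by lia.
move=> /(_ isT).
move: #|containing H| #|containing (H :\ _)| #|containing set0| (2 * d ^ 2) => a b g C h1 h2.
rewrite mulnA; apply: leq_trans (leq_mul h1 (leqnn _)) _.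
by rewrite -!mulnA leq_mul2l h2 orbT.
Qed.

End Switching.

(** * First moment bound for dense vertex sets *)

Lemma card_bigcup_le (I T : finType) (P : pred I) (F : I -> {set T}) :
  #|\bigcup_(i | P i) F i| <= \sum_(i | P i) #|F i|.
Proof.
elim/big_rec2: _ => [|i m A _ IH]; first by rewrite cards0.
by apply: leq_trans (leq_card_setU _ _) _; rewrite leq_add2l.
Qed.

Section SparseCount.
Variables (d k : nat) (V : finType).
Hypothesis d_gt0 : 0 < d.
Local Notation C := (2 * d ^ 2).
Local Notation n := #|V|.

Definition dense_graphs := [set G : sgraph V | regular d G && ~~ sparse k G].

Lemma bin_le_expn N a : 'C(N, a) <= N ^ a.
Proof.
apply: (@leq_trans (N ^_ a)); first by rewrite -bin_ffact leq_pmulr ?fact_gt0.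
rewrite ffact_prod -[a in N ^ a]card_ord -prod_nat_const.
by apply: leq_prod => i _; rewrite leq_subr.
Qed.

Local Open Scope ring_scope.

Hypothesis n_large : (C + 2 * (2 * 2 ^ k + 2 * d + 2) <= n)%N.

Let n_gt0 : 0 < n%:R :> rat.
Proof. by rewrite ltr0n; apply: leq_trans n_large; lia. Qed.

Lemma card_containing_le (X : {set V}) (H : {set {set V}}) :
  (#|X| <= k)%N -> H \subset powerset X -> (#|X| < #|H|)%N ->
  #|containing d H|%:R <= 
    (C ^ k.+1)%:R * #|containing d (set0 : {set {set V}})|%:R * n%:R ^- #|X|.+1 :> rat.
Proof.
move=> Xk HX XH.
have Hk : (#|H| <= 2 ^ k)%N.
  apply: leq_trans (subset_leq_card HX) _; rewrite card_powerset.
  by rewrite leq_exp2l.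
have nC : (C <= n)%N by apply: leq_trans n_large; apply: leq_addr.
have := card_containing d_gt0 Hk (leq_trans (leq_addl _ _) n_large).
(* The [j] edges of [H] beyond [#|X| + 1] are discarded, since each contributes a factor [C / n] of
   at most 1. *)
rewrite -(subnK XH); set j := (#|H| - _)%N; rewrite !expnD => le1.
have n0 : (0 < n)%N by rewrite -(ltr0n rat).
have C0 : (0 < C)%N by rewrite muln_gt0 expn_gt0 d_gt0.
have le2 : (#|containing d H| * n ^ #|X|.+1 <=
    C ^ #|X|.+1 * #|containing d (set0 : {set {set V}})|)%N.
  have nj : (0 < n ^ j)%N by rewrite expn_gt0 n0.
  rewrite -(leq_pmul2l nj); apply: (@leq_trans (#|containing d H| * (n ^ j * n ^ #|X|.+1))%N).
    by rewrite mulnCA.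
  apply: leq_trans le1 _; rewrite -mulnA leq_mul2r; apply/orP; right.
  by case: (j) => // i; rewrite leq_exp2r.
rewrite ler_pdivlMr ?exprn_gt0 // -natrX -!natrM ler_nat.
apply: leq_trans le2 _; rewrite leq_mul2r; apply/orP; right.
by rewrite leq_pexp2l // ltnS.
Qed.

(** There are at most [n ^ a] sets of size [a], so each of the [k + 1] sizes contributes at most
    1. *)
Lemma sum_small_sets : \sum_(X : {set V} | (#|X| <= k)%N) n%:R ^- #|X| <= k.+1%:R :> rat.
Proof.
rewrite (partition_big (fun X : {set V} => inord #|X| : 'I_k.+1) predT) //=.
apply: (@le_trans _ _ (\sum_(a < k.+1) 1)); last by rewrite sumr_const card_ord.
apply: ler_sum => a _.
rewrite (eq_big (fun X : {set V} => #|X| == a) (fun=> n%:R ^- a)) => [|X|X].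
- rewrite sumr_const -[X in _ *+ X]cardsE card_draws -(mulr_natl (n%:R ^- a)).
  by rewrite ler_pdivrMr ?exprn_gt0 // mul1r -natrX ler_nat bin_le_expn.
- apply/andP/eqP => [[Xk /eqP <-]|Xa]; first by rewrite inordK.
  by rewrite Xa -ltnS ltn_ord; split=> //; apply/eqP/val_inj; rewrite /= inordK.
- by case/andP => Xk /eqP <-; rewrite inordK.
Qed.

(** The factors bound the number of edge sets inside [X], the cost of the switchings and the number
    of sizes of [X]. *)
Definition sparse_const : nat := (2 ^ 2 ^ k * C ^ k.+1 * k.+1)%N.

(** A union bound over the dense set [X] and its inner edges [H]: the surplus edge leaves one factor
    [1 / n] after summing over [X]. *)
Lemma card_dense : #|dense_graphs|%:R <=
  sparse_const%:R * #|containing d (set0 : {set {set V}})|%:R / n%:R :> rat.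
Proof.
pose P (X : {set V}) (H : {set {set V}}) := (H \subset powerset X) && (#|X| < #|H|)%N.
apply: (@le_trans _ _ (\sum_(X : {set V} | (#|X| <= k)%N) \sum_(H | P X H) #|containing d H|%:R)).
  have sub : dense_graphs \subset
     \bigcup_(X : {set V} | (#|X| <= k)%N) \bigcup_(H | P X H) containing d H.
    apply/subsetP => G; rewrite inE => /andP[rG /forallPn[X]].
    rewrite negb_imply -ltnNge => /andP[Xk Xi].
    apply/bigcupP; exists X => //; apply/bigcupP; exists (inner_edges G X).
      rewrite /P Xi andbT; apply/subsetP => z; rewrite !inE; by case/andP.
    by rewrite inE rG; apply/subsetP => z; rewrite inE => /andP[].
  under [leRHS]eq_bigr do rewrite -natr_sum.
  rewrite -natr_sum ler_nat; apply: leq_trans (subset_leq_card sub) _.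
  by apply: leq_trans (card_bigcup_le _ _) _; apply: leq_sum => X _; apply: card_bigcup_le.
apply: (@le_trans _ _ (\sum_(X : {set V} | (#|X| <= k)%N)
   (2 ^ 2 ^ k)%:R * ((C ^ k.+1)%:R * #|containing d (set0 : {set {set V}})|%:R *
     n%:R ^- #|X|.+1))).
  apply: ler_sum => X Xk; set y := _ * _ ^- _.
  apply: (@le_trans _ _ (\sum_(H | P X H) y)).
    by apply: ler_sum => H /andP[HX XH]; apply: card_containing_le.
  rewrite sumr_const -(mulr_natl y); apply: ler_wpM2r.
    by rewrite !mulr_ge0 // invr_ge0 exprn_ge0.
  rewrite ler_nat -[#|_|]cardsE.
  apply: (@leq_trans #|powerset (powerset X)|).
    by apply/subset_leq_card/subsetP => H; rewrite !inE => /andP[].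
  by rewrite !card_powerset !leq_exp2l.
rewrite -mulr_sumr.
have -> : \sum_(X : {set V} | (#|X| <= k)%N)
    (C ^ k.+1)%:R * #|containing d (set0 : {set {set V}})|%:R * n%:R ^- #|X|.+1
  = (C ^ k.+1)%:R * #|containing d (set0 : {set {set V}})|%:R / n%:R *
    \sum_(X : {set V} | (#|X| <= k)%N) n%:R ^- #|X| :> rat.
  rewrite mulr_sumr; apply: eq_bigr => X _; rewrite exprS invfM; ring.
apply: (@le_trans _ _ ((2 ^ 2 ^ k)%:R *
  ((C ^ k.+1)%:R * #|containing d (set0 : {set {set V}})|%:R / n%:R * k.+1%:R))).
  apply: ler_wpM2l => //; apply: ler_wpM2l; first by rewrite divr_ge0 ?mulr_ge0.
  exact: sum_small_sets.
by rewrite /sparse_const 2!natrM le_eqVlt; apply/orP; left; apply/eqP; ring.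
Qed.

End SparseCount.

(* Passage to the limit *)
From mathcomp Require Import boolp classical_sets reals topology normedtype.

Import numFieldNormedType.Exports.
Local Open Scope classical_set_scope.
Local Open Scope ring_scope.

Lemma card_dense_nat (d k n : nat) : (0 < d)%N ->
  (2 * d ^ 2 + 2 * (2 * 2 ^ k + 2 * d + 2) <= n)%N ->
  (#|dense_graphs d k 'I_n| * n <= sparse_const d k * #|regular_graphs n d|)%N.
Proof.
move=> d0 nl; have cV : #|'I_n| = n := card_ord n.
have := @card_dense d k 'I_n d0; rewrite cV => /(_ nl).
have n0 : (0 < n)%N by apply: leq_trans nl; lia.
rewrite ler_pdivlMr ?ltr0n // -!natrM ler_nat => /leq_trans; apply.
rewrite leq_mul2l; apply/orP; right; apply/subset_leq_card/fintype.subsetP => G.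
by rewrite !inE => /andP[].
Qed.

Theorem theorem1p3 (R : realType) (d : nat) (hd : odd d) :
  uniform_prob R (regular_graphs n d) (@strongly_consistent 'I_n)
    @[n --> within [set n : nat | (0 < #|regular_graphs n d|)%N] \oo]
    --> (1 : R).
Proof.
have d_gt0 : (0 < d)%N by case: (d) hd.
have [k kP] := sparse_strongly_consistent hd.
apply/cvgrPdist_le => eps eps0.
pose M := sparse_const d k.
(* The first threshold is the size condition of [card_dense_nat]; the second makes [M / n] at most
   [eps]. *)
exists (maxn (2 * d ^ 2 + 2 * (2 * 2 ^ k + 2 * d + 2)) (Num.bound (M%:R / eps))) => // n /=.
rewrite geq_max => /andP[nl neps] g0.
have n0 : (0 < n)%N by apply: leq_trans nl; lia.
rewrite /uniform_prob; set A := regular_graphs n d in g0 *.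
set Q := finset.finset _.
have gR : 0 < #|A|%:R :> R by rewrite ltr0n.
have QA : (Q \subset A)%N by apply/fintype.subsetP => G; rewrite inE => /andP[].
have -> : 1 - #|Q|%:R / #|A|%:R = (#|A :\: Q|)%:R / #|A|%:R :> R.
  by rewrite cardsD (finset.setIidPr QA) natrB ?subset_leq_card // mulrBl divff // gt_eqF.
rewrite ger0_norm ?divr_ge0 //.
(* A regular graph that is not strongly consistent fails to be sparse. *)
have dense : (#|A :\: Q| * n <= M * #|A|)%N.
  apply: leq_trans (card_dense_nat d_gt0 nl); rewrite leq_mul2r; apply/orP; right.
  apply/subset_leq_card/fintype.subsetP => G; rewrite !inE => /andP[+ rG].
  rewrite rG /=; apply: contra => sG; apply/asboolP; exact: kP rG sG.
rewrite ler_pdivrMr // -(ler_pM2r (_ : 0 < n%:R)) ?ltr0n //.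
apply: (@le_trans _ _ (M%:R * #|A|%:R)); first by rewrite -!natrM ler_nat.
rewrite mulrAC ler_pM2r //; have : M%:R / eps < (Num.bound (M%:R / eps))%:R.
  by apply: archi_boundP; rewrite divr_ge0 // ltW.
rewrite ltr_pdivrMr // => /ltW/le_trans; apply; rewrite mulrC ler_pM2l // ler_nat //.
Qed.
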